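(* For every integer $d\ge 3$, the class of $(d+1)$-regular graphs that are dual graphs of triangulations of $d$-manifolds is not small. In particular, for every $d\ge 3$ there are graphs with arbitrarily large twin-width in this class.
   Context: Small class: an infinite class $\mathcal{G}$ of graphs is small if there exists a constant $c>1$ such that for every $n\in\mathbb{N}$ the class $\mathcal{G}$ contains at most $n!\,c^n$ labeled graphs on $n$ vertices (i.e. graphs with vertex set $\{1,\dots,n\}$ that are isomorphic to a member of $\mathcal{G}$). A graph is $k$-regular if every vertex has degree $k$. Manifolds: a $d$-manifold is a second countable Hausdorff space in which every point has an open neighborhood homeomorphic to $\mathbb{R}^d$ or to the closed half-space $\{x\in\mathbb{R}^d: x_1\ge 0\}$. All manifolds considered are compact. Triangulation and dual graph: a triangulation of a compact $d$-manifold $M$ is a finite (abstract) simplicial complex $T$ whose geometric realization is homeomorphic to $M$. It is pure of dimension $d$. Its dual graph is the simple graph whose vertices are the $d$-simplices of $T$, two of them being adjacent if and only if they share a $(d-1)$-dimensional face. Twin-width: a trigraph is a triple $G=(V,E,R)$ with $V$ a finite set and $E,R\subseteq\binom{V}{2}$ disjoint sets of black and red edges; a simple graph is a trigraph with $R=\emptyset$. The red degree of a vertex is the number of red edges incident to it. For distinct $u,v\in V$, the contraction $G/u,v=(V',E',R')$ has $V'=(V\setminus\{u,v\})\cup\{w\}$ for a new vertex $w$; all (black/red) edges among vertices of $V\setminus\{u,v\}$ are unchanged; and for $x\in V\setminus\{u,v\}$: $\{w,x\}\in E'$ iff $\{u,x\}\in E$ and $\{v,x\}\in E$; $\{w,x\}\notin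 E'\cup R'$ iff $\{u,x\}\notin E\cup R$ and $\{v,x\}\notin E\cup R$; and $\{w,x\}\in R'$ otherwise. A contraction sequence is a sequence of trigraphs each of which (after the first) is a contraction of the preceding one; its width is the maximum red degree of any vertex in any trigraph of the sequence. The twin-width $\operatorname{tww}(G)$ is the minimum width of a contraction sequence starting at $G$ and ending at a one-vertex trigraph. *)

(* Defs.v *)
From HB Require Import structures.
From mathcomp Require Import all_boot all_order all_algebra.
From mathcomp Require Import all_classical all_reals all_analysis.

Set Implicit Arguments.
Unset Strict Implicit.
Unset Printing Implicit Defensive.

Import Order.TTheory GRing.Theory Num.Theory.
Import numFieldNormedType.Exports.

Local Open Scope ring_scope.

(** * Finite simple graphs and classes of graphs *)

Record sgraph := SGraph {
  vert :> finType;
  adj : rel vert;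
  adj_sym : symmetric adj;
  adj_irr : irreflexive adj }.

Definition regular (k : nat) (G : sgraph) : Prop :=
  forall x : G, #|[pred y | adj x y]| = k.

Definition isomorphic (G H : sgraph) : Prop :=
  exists2 f : G -> H, bijective f & forall x y, adj (f x) (f y) = adj x y.

Definition infinite_class (C : sgraph -> Prop) : Prop :=
  ~ exists (m : nat) (H : 'I_m -> sgraph),
      forall G, C G -> exists i, isomorphic G (H i).

(* A graph with vertex set 'I_n is identified with its adjacency matrix, so
   that the labeled graphs on n vertices form a finite type; equality of
   matrices is equality of labeled graphs. *)
Definition labeled_graphs (C : sgraph -> Prop) (n : nat) : {set 'M[bool]_n} :=
  finset (fun A : 'M[bool]_n =>
    `[< exists2 G, C G &
          exists2 f : 'I_n -> G,
            bijective f & forall i j, A i j = adj (f i) (f j) >]).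

(* The counting condition only: smallness is a notion for classes that are
   also infinite_class. *)
Definition small (R : realType) (C : sgraph -> Prop) : Prop :=
  exists2 c : R, 1 < c &
    forall n : nat, #|labeled_graphs C n|%:R <= n`!%:R * c ^+ n.

(** * Twin-width *)

Record trigraph := Trigraph {
  tvert :> finType;
  black : rel tvert;
  red : rel tvert;
  black_sym : symmetric black;
  black_irr : irreflexive black;
  red_sym : symmetric red;
  red_irr : irreflexive red;
  black_red_disjoint : forall x y, ~~ (black x y && red x y) }.

Definition trigraph_of_sgraph (G : sgraph) : trigraph.
Proof.
refine (@Trigraph (vert G) (@adj G) (fun _ _ => false)
  (@adj_sym G) (@adj_irr G) _ _ _) => //.
by move=> x y; rewrite andbF.
Defined.

Section Contraction.
Variables (G : trigraph) (u v : G).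

(* [None] is the vertex w resulting from merging u and v. *)
Definition contract_vert : finType := option {x : G | (x != u) && (x != v)}.

Definition contract_black (a b : contract_vert) : bool :=
  match a, b with
  | Some x, Some y => black (val x) (val y)
  | None, Some x | Some x, None => black u (val x) && black v (val x)
  | None, None => false
  end.

Definition contract_red (a b : contract_vert) : bool :=
  match a, b with
  | Some x, Some y => red (val x) (val y)
  | None, Some x | Some x, None =>
      ~~ (black u (val x) && black v (val x)) &&
      ~~ (~~ (black u (val x) || red u (val x)) &&
          ~~ (black v (val x) || red v (val x)))
  | None, None => false
  end.

Definition contraction : trigraph.
Proof.
refine (@Trigraph contract_vert contract_black contract_red _ _ _ _ _).
- by case=> [x|] [y|] //=; rewrite black_sym.
- by case=> [x|] //=; rewrite black_irr.
- by case=> [x|] [y|] //=; rewrite red_sym.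
- by case=> [x|] //=; rewrite red_irr.
- case=> [x|] [y|] //=; first exact: black_red_disjoint.
  + by rewrite andbA andbN.
  + by rewrite andbA andbN.
Defined.

End Contraction.

Definition max_red_degree (G : trigraph) : nat :=
  \max_(x : G) #|[pred y | red x y]|.

(* [contraction_sequence G H k]: there is a contraction sequence of width k
   starting at G and ending at H. *)
Inductive contraction_sequence : trigraph -> trigraph -> nat -> Prop :=
| ContractionSequence0 (G : trigraph) : contraction_sequence G G (max_red_degree G)
| ContractionSequenceS (G : trigraph) (u v : G) (H : trigraph) (k : nat) :
    u != v -> contraction_sequence (contraction u v) H k ->
    contraction_sequence G H (maxn (max_red_degree G) k).

Definition full_contraction_sequence (G : trigraph) (k : nat) : Prop :=
  exists2 H : trigraph, #|H| = 1%N & contraction_sequence G H k.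

Definition is_twin_width (G : trigraph) (k : nat) : Prop :=
  full_contraction_sequence G k /\
  forall j, full_contraction_sequence G j -> (k <= j)%N.

(** * Manifolds *)

Definition homeomorphic (X Y : topologicalType) : Prop :=
  exists (f : X -> Y) (g : Y -> X),
    [/\ continuous f, continuous g, cancel f g & cancel g f].

Definition halfspace (R : realType) (d : nat) : set 'rV[R]_d :=
  [set x : 'rV[R]_d | forall i : 'I_d, val i = 0%N -> 0 <= x ord0 i]%classic.
Arguments halfspace : clear implicits.

(* [set_type A] carries the subspace topology. *)
Definition manifold (R : realType) (d : nat) (M : topologicalType) : Prop :=
  [/\ @second_countable M, hausdorff_space M &
      forall x : M, exists U : set M,
        [/\ open U, U x &
            homeomorphic (set_type U) 'rV[R]_d \/
            homeomorphic (set_type U) (set_type (halfspace R d))]].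

Definition compact_manifold (R : realType) (d : nat) (M : topologicalType) :
    Prop :=
  manifold R d M /\ compact [set: M]%classic.

(** * Triangulations and their dual graphs *)

(* Simplices are nonempty. The vertices of the complex are the i such that
   [set i] is a simplex; not every i : 'I_m need be one. *)
Definition simplicial_complex (m : nat) (T : {set {set 'I_m}}) : Prop :=
  finset.set0 \notin T /\
  forall s t : {set 'I_m}, s \in T -> t \subset s -> t != finset.set0 -> t \in T.

Definition realization (R : realType) (m : nat) (T : {set {set 'I_m}}) :
    set 'rV[R]_m :=
  [set x : 'rV[R]_m | [/\ forall i, 0 <= x ord0 i, \sum_i x ord0 i = 1 &
               finset (fun i => x ord0 i != 0) \in T]]%classic.
Arguments realization : clear implicits.

Definition triangulation (R : realType) (m : nat) (T : {set {set 'I_m}})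
    (M : topologicalType) : Prop :=
  simplicial_complex T /\ homeomorphic (set_type (realization R m T)) M.

Section DualGraph.
Variables (d m : nat) (T : {set {set 'I_m}}).

Definition facet : finType :=
  {s : {set 'I_m} | (s \in T) && (#|s| == d.+1)}.

Definition facet_adj (s t : facet) : bool :=
  (s != t) &&
  [exists r in T, [&& #|r| == d, r \subset val s & r \subset val t]].

Definition dual_graph : sgraph.
Proof.
refine (@SGraph facet facet_adj _ _).
- move=> s t; rewrite /facet_adj eq_sym; congr (_ && _).
  by apply: eq_existsb => r; rewrite [(r \subset val s) && _]andbC.
- by move=> s; rewrite /facet_adj eqxx.
Defined.

End DualGraph.

Definition regular_dual_graphs (R : realType) (d : nat) (G : sgraph) : Prop :=
  regular d.+1 G /\
  exists (M : topologicalType) (m : nat) (T : {set {set 'I_m}}),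
    [/\ compact_manifold R d M, triangulation R T M &
        isomorphic G (dual_graph d T)].

(* Main.v *)
(** Let [sigma] be a permutation of an [n]-element set. It prescribes a gluing of [O(n)] hexagons
    into a closed surface, and the product of this surface with [d - 2] circles has a coloured
    triangulation with [N = O(n)] facets. From the dual graph one recovers [sigma] up to
    [2 ^ O(N)] choices: it suffices to know the colours of its edges and one facet, since the
    other facets are reached by moves that do not depend on [sigma]. So there are at least
    [n! * N! / 2 ^ O(N)] labelled dual graphs with [N] vertices, and the class is not small.

    The product of two coloured complexes is homeomorphic to the product of the spaces: a point
    is a probability on pairs of vertices whose support is a chain, hence it is the monotone
    coupling of its two marginals, and that coupling is continuous in the marginals.

    Graphs of bounded degree and bounded twin-width are small: a contraction sequence yields a
    linear order of the vertices in which every quotient of the adjacency matrix by [b]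
    intervals has only [O(b)] nonzero entries (its rows can be removed one at a time, always one
    with a bounded number of nonzero entries left), and repeated halving bounds the number of
    such matrices by [2 ^ O(n)]. A class with finitely many graphs up to isomorphism, or a class
    of bounded twin-width, would thus be small. *)
Require Import Defs.
From HB Require Import structures.
From mathcomp Require Import all_boot all_order all_algebra.
From mathcomp Require Import perm zify.

Set Implicit Arguments.
Unset Strict Implicit.
Unset Printing Implicit Defensive.

(** * Graphs of bounded degree and bounded twin-width *)

(** Around a hexagon, the three sides that carry permutations alternate with three sides that only
    flip a bit. The two mirrors at a corner therefore commute and exactly four hexagons meet there,
    so that every vertex link is an explicit cycle, of length 4, 8 or 12, whatever [sigma] is. Of
    the three permutations, the identity and a cyclic shift make all hexagons reachable by fixed
    moves; only the third one is [sigma].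

    Colours serve twice. They order the vertices of a facet, as the staircase subdivision of a
    product requires, and they name the edges of the dual graph at the cost of a bounded factor per
    facet. Each circle is a 4-cycle whose opposite vertices have the same colour, so the product is
    coloured again. As the number of facets is a fixed multiple of the size of the permuted set, the
    surplus [n!] beats every exponential in the number of facets. *)

Section BlockDegeneracy.
Variables (V : finType) (e : rel V) (N : nat) (beta : V -> 'I_N).
Implicit Types (S : {set V}).

Definition blocks S : {set 'I_N} := [set beta x | x in S].

(** The columns of the nonzero entries in the row of the block of [z], in the quotient of the matrix
    of [S] by [beta]. *)
Definition block_nbrs S (z : V) : {set 'I_N} :=
  [set beta y | y in [set y in S | [exists x in S, (beta x == beta z) && e x y]]].

Definition block_edges S : {set 'I_N * 'I_N} :=
  [set (beta p.1, beta p.2) | p in [set p | [&& p.1 \in S, p.2 \in S & e p.1 p.2]]].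

(** Deleting the whole block of [z], not just [z], removes one block, at most [C] entries in its row
    and, by symmetry, at most [C] in its column. *)
Lemma card_block_edges (C : nat) (e_sym : symmetric e) :
  (forall S, S != set0 -> exists2 z, z \in S & #|block_nbrs S z| <= C) ->
  forall S, #|block_edges S| <= C.*2 * #|blocks S|.
Proof.
move=> degen S; have [n] := ubnP #|S|; elim: n S => // n IHn S leSn.
have [->|/degen[z zS degz]] := eqVneq S set0.
  rewrite /block_edges (_ : [set _ | _] = set0) ?imset0 ?cards0 //.
  by apply/setP=> p; rewrite !inE.
pose S' := [set x in S | beta x != beta z].
have sub: block_edges S \subset block_edges S' :|:
    ([set (beta z, b) | b in block_nbrs S z] :|: [set (b, beta z) | b in block_nbrs S z]).
  apply/subsetP=> w /imsetP[[x y]]; rewrite inE /= => /and3P[xS yS exy] ->.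
  rewrite !inE; have [xz|xz] := eqVneq (beta x) (beta z).
    apply/or3P/Or32/imsetP; exists (beta y); last by rewrite xz.
    apply/imsetP; exists y => //; rewrite inE yS; apply/existsP; exists x.
    by rewrite xS xz eqxx.
  have [yz|yz] := eqVneq (beta y) (beta z).
    apply/or3P/Or33/imsetP; exists (beta x); last by rewrite yz.
    apply/imsetP; exists x => //; rewrite inE xS; apply/existsP; exists y.
    by rewrite yS yz eqxx e_sym.
  apply/or3P/Or31/imsetP; exists (x, y) => //.
  by rewrite !inE /= xS yS xz yz.
have ltS : #|S'| < #|S|.
  apply/proper_card/properP; split; first by apply/subsetP=> x; rewrite inE => /andP[].
  by exists z; rewrite // inE eqxx andbF.
have IH := IHn S' (leq_trans ltS leSn).
have blS : #|blocks S'| < #|blocks S|.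
  apply/proper_card/properP; split.
    by apply/imsetS/subsetP=> x; rewrite inE => /andP[].
  exists (beta z); first exact: imset_f.
  by apply/imsetP=> -[x]; rewrite inE => /andP[_ /eqP h] /esym.
apply: (leq_trans (subset_leq_card sub)); apply: leq_trans (leq_card_setU _ _).1 _.
have cnbr : #|[set (beta z, b) | b in block_nbrs S z]
               :|: [set (b, beta z) | b in block_nbrs S z]| <= C.*2.
  apply: leq_trans (leq_card_setU _ _).1 _; rewrite -addnn.
  by apply: leq_add; apply: leq_trans (leq_imset_card _ _) degz.
apply: leq_trans (leq_add IH cnbr) _.
by rewrite addnC -mulnS leq_mul2l blS orbT.
Qed.

End BlockDegeneracy.

Section ContractionOrder.
Variables (V : finType) (e : rel V).

(* The fibres of [phi] are the parts of a partition of [V] whose quotient trigraph is [H]. *)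
Definition quotient_map (H : trigraph) (phi : V -> H) : Prop :=
  [/\ forall h, exists x, phi x = h,
      forall x y, e x y -> [\/ phi x = phi y, black (phi x) (phi y) | red (phi x) (phi y)] &
      forall x y, black (phi x) (phi y) -> e x y].

(** A black edge of the quotient joins all vertices of one part to all of the other, so
    representatives of the black neighbours are distinct neighbours of a single vertex. Twin-width
    controls the red edges only; the degree bound takes care of the black ones. *)
Lemma black_degree (H : trigraph) (phi : V -> H) (D : nat) :
  quotient_map phi -> (forall x, #|[pred y | e x y]| <= D) ->
  forall h : H, #|[pred g | black h g]| <= D.
Proof.
case=> surj _ blk degD h; have [x <-] := surj h.
apply: leq_trans (degD x).
have pick g : exists y, phi y == g by have [y <-] := surj g; exists y.
pose s g := xchoose (pick g).
have sK g : phi (s g) = g by apply/eqP/(xchooseP (pick g)).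
rewrite -(card_image (f := s)); last by move=> a b eab; rewrite -(sK a) eab sK.
apply: subset_leq_card; apply/subsetP=> y /imageP[g]; rewrite !inE => hg ->.
by apply: blk; rewrite sK.
Qed.

(** [insub] fails exactly on [u] and [v], and [None] is the merged vertex. *)
Definition fold_pair (H : trigraph) (u v : H) (x : H) : contraction u v :=
  insub x : contract_vert u v.

Variant fold_pair_spec (H : trigraph) (u v x : H) : contraction u v -> Type :=
| FoldSome (p : (x != u) && (x != v)) :
    fold_pair_spec x (Some (Sub x p) : contract_vert u v)
| FoldNone of (x == u) || (x == v) : fold_pair_spec x (None : contract_vert u v).

Lemma fold_pairP (H : trigraph) (u v x : H) : fold_pair_spec x (fold_pair u v x).
Proof.
rewrite /fold_pair; case: insubP => [y px yx|npx].
  by move: px; rewrite -yx => px; rewrite (_ : y = Sub (val y) px); [constructor|exact: val_inj].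
by constructor; rewrite negb_and !negbK in npx.
Qed.

Lemma quotient_map_contraction (H : trigraph) (u v : H) (phi : V -> H) :
  quotient_map phi -> quotient_map (fun x => fold_pair u v (phi x)).
Proof.
case=> surj adjP blk; split.
- case=> [[h hP]|].
    have [x xh] := surj h; exists x; case: fold_pairP; rewrite xh; last first.
      by rewrite -[_ || _]negbK negb_or hP.
    by move=> p; congr Some; apply: val_inj.
  have [x xu] := surj u; exists x; case: fold_pairP => //; rewrite xu.
  by move=> p; have := p; rewrite eqxx.
- move=> x y exy; have := adjP x y exy.
  case: fold_pairP => [px|px]; case: fold_pairP => [py|py] /=.
  + case=> [E|b|r]; [constructor 1|by constructor 2|by constructor 3].
    by congr Some; apply: val_inj.
  + case=> [E|b|r]; first by have /andP[/negPf h1 /negPf h2] := px; rewrite -E h1 h2 in py.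
      case: (boolP (black u (phi x) && black v (phi x))) => [|nb]; first by constructor 2.
      constructor 3; rewrite black_sym in b.
      by case/orP: py => /eqP <-; rewrite b /= ?andbF.
    case: (boolP (black u (phi x) && black v (phi x))) => [|nb]; first by constructor 2.
    constructor 3; rewrite red_sym in r.
    by case/orP: py => /eqP <-; rewrite r /= ?orbT ?andbF.
  + case=> [E|b|r]; first by have /andP[/negPf h1 /negPf h2] := py; rewrite E h1 h2 in px.
      case: (boolP (black u (phi y) && black v (phi y))) => [|nb]; first by constructor 2.
      constructor 3.
      by case/orP: px => /eqP <-; rewrite b /= ?andbF.
    case: (boolP (black u (phi y) && black v (phi y))) => [|nb]; first by constructor 2.
    constructor 3.
    by case/orP: px => /eqP <-; rewrite r /= ?orbT ?andbF.
  + by constructor 1.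
- move=> x y; case: fold_pairP => [px|px]; case: fold_pairP => [py|py] //=.
  + exact: blk.
  + case/andP=> bu bv; apply: blk; rewrite black_sym.
    by case/orP: py => /eqP ->.
  + case/andP=> bu bv; apply: blk.
    by case/orP: px => /eqP ->.
Qed.

End ContractionOrder.

Lemma card_ord_gt2 (N : nat) (A : {set 'I_N}) :
  2 < #|A| -> exists a b c, [/\ a \in A, b \in A, c \in A & a < b < c].
Proof.
case/card_gt2P=> x [y [z [[xA yA zA] [xy yz zx]]]].
have {}xy : x <> y :> nat by move=> E; move/eqP: xy; apply; apply: val_inj.
have {}yz : y <> z :> nat by move=> E; move/eqP: yz; apply; apply: val_inj.
have {}zx : z <> x :> nat by move=> E; move/eqP: zx; apply; apply: val_inj.
case: (ltngtP x y) xy => // xy _; case: (ltngtP y z) yz => // yz _;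
  case: (ltngtP z x) zx => // zx _; try lia.
- by exists x, y, z; rewrite xy yz.
- by exists z, x, y; rewrite xy zx.
- by exists x, z, y; rewrite zx yz.
- by exists y, z, x; rewrite zx yz.
- by exists y, x, z; rewrite zx xy.
- by exists z, y, x; rewrite xy yz.
Qed.

Lemma leq_card_bigcup (I T : finType) (P : {set I}) (F : I -> {set T}) :
  #|\bigcup_(i in P) F i| <= \sum_(i in P) #|F i|.
Proof.
elim/big_rec2: _ => [|i m A _ le]; first by rewrite cards0.
by apply: leq_trans (leq_card_setU _ _).1 _; rewrite leq_add2l.
Qed.

Section FibreBlocks.
Variables (V : finType) (e : rel V) (H : trigraph) (phi : V -> H) (N : nat) (beta : V -> 'I_N).
Variable (S : {set V}).

Local Notation fibre h := [set x in S | phi x == h].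

(** A block inside the part [h] sees only [h] and its at most [D] black and [K] red neighbours, and
    each of these parts meets at most four blocks. *)
Lemma block_nbrs_fibre (K D : nat) (h : H) (z : V) :
  quotient_map e phi -> (forall x, #|[pred y | e x y]| <= D) -> max_red_degree H <= K ->
  (forall g, #|blocks beta (fibre g)| <= 4) ->
  (forall x, x \in S -> beta x = beta z -> phi x = h) ->
  #|block_nbrs e beta S z| <= 4 * (K + D).+1.
Proof.
move=> qm degD redK le4 zh; have [_ adjP _] := qm.
pose Q := h |: [set g | black h g] :|: [set g | red h g].
have cQ : #|Q| <= (K + D).+1.
  have blD : #|[set g | black h g]| <= D.
    by rewrite cardsE; apply: black_degree qm degD h.
  have rdK : #|[set g | red h g]| <= K.
    by rewrite cardsE; apply: leq_trans redK; apply: (leq_bigmax h).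
  apply: leq_trans (leq_card_setU _ _).1 _.
  rewrite (_ : (K + D).+1 = (1 + D) + K); last by rewrite addnAC add1n addSn addnC.
  by rewrite leq_add // cardsU1 leq_add // leq_b1.
have sub : block_nbrs e beta S z \subset \bigcup_(g in Q) blocks beta (fibre g).
  apply/subsetP=> w /imsetP[y]; rewrite inE => /andP[yS /existsP[x]].
  case/and3P=> xS /eqP bx exy ->; apply/bigcupP; exists (phi y); last first.
    by apply/imsetP; exists y; rewrite // inE yS eqxx.
  rewrite !inE -(zh x xS bx); case: (adjP x y exy) => [->|->|->];
  by rewrite ?eqxx ?orbT.
apply: leq_trans (subset_leq_card sub) _; apply: leq_trans (leq_card_bigcup _ _) _.
apply: (@leq_trans (\sum_(g in Q) 4)); first by apply: leq_sum.
by rewrite sum_nat_const mulnC leq_mul2l cQ.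
Qed.

(** If [h] met three blocks, the middle one would contain a vertex of another part. That part comes
    before or after [h] in the order [r], which contradicts the monotonicity of [beta] against the
    first or the last block. *)
Lemma card_fibre_blocks (r : H -> nat) (h : H) :
  injective r -> {in S &, forall x y, r (phi x) < r (phi y) -> beta x <= beta y} ->
  (forall z, z \in S -> exists x, [/\ x \in S, beta x = beta z & phi x != h]) ->
  #|blocks beta (fibre h)| <= 2.
Proof.
move=> rI mono nofull; rewrite leqNgt; apply/negP=> /card_ord_gt2[a [b [c []]]].
case/imsetP=> x; rewrite inE => /andP[xS /eqP xh] ->.
case/imsetP=> y; rewrite inE => /andP[yS /eqP yh] ->.
case/imsetP=> z; rewrite inE => /andP[zS /eqP zh] -> /andP[xy yz].
have [w [wS wy wh]] := nofull y yS.
case: (ltngtP (r (phi w)) (r h)) => [lt|gt|/rI E]; last by rewrite E eqxx in wh.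
  by have := mono w x wS xS; rewrite xh lt wy => /(_ isT); rewrite leqNgt xy.
by have := mono z w zS wS; rewrite zh gt wy => /(_ isT); rewrite leqNgt yz.
Qed.

End FibreBlocks.

(* At the first moment of the contraction sequence when a part contains a whole block, that
   block only sees blocks met by the at most [K + D] neighbouring parts, and before that
   moment a part, being an interval, met at most two blocks. *)
Lemma contraction_order (H H1 : trigraph) (k : nat) :
  contraction_sequence H H1 k -> #|H1| = 1 ->
  exists2 r : H -> nat, injective r &
    forall (V : finType) (e : rel V) (phi : V -> H) (K D N : nat) (beta : V -> 'I_N) (S : {set V}),
      k <= K -> quotient_map e phi -> (forall x, #|[pred y | e x y]| <= D) ->
      {in S &, forall x y, r (phi x) < r (phi y) -> beta x <= beta y} ->
      (forall g, #|blocks beta [set x in S | phi x == g]| <= 4) -> S != set0 ->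
      exists2 z, z \in S & #|block_nbrs e beta S z| <= 4 * (K + D).+1.
Proof.
elim=> [G G1|G u v H' k' uv _ IH H'1].
  have /fintype_le1P eqG : #|G| <= 1 by rewrite G1.
  exists (fun _ => 0) => [x y _|V e phi K D N beta S kK qm degD _ le4 /set0Pn[z zS]].
    exact: eqG.
  exists z => //; apply: (block_nbrs_fibre (h := phi z) qm degD kK le4) => x _ _.
  exact: eqG.
have [r' r'I {}IH] := IH H'1.
(* The order for the contracted trigraph with the merged vertex replaced by [u], then [v]; doubling
   makes room for the pair. *)
pose r x := (r' (fold_pair u v x)).*2 + (x == v).
have rI : injective r.
  move=> x y E; have Ef : fold_pair u v x = fold_pair u v y.
    apply: r'I; move: E; rewrite /r; lia.
  have Ev : (x == v) = (y == v) by move: E; rewrite /r Ef; case: eqP; case: eqP; lia.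
  move: Ef; case: fold_pairP => [px|px]; case: fold_pairP => [py|py] //; first by case.
  move: px py; rewrite Ev; case: (eqVneq y v) Ev => [-> /eqP->|_ _] //.
  by rewrite !orbF => /eqP-> /eqP->.
exists r => // V e phi K D N beta S; rewrite geq_max => /andP[redK kK] qm degD mono le4 S0.
have [|nofull] :=
  boolP [exists z in S, [exists h, [forall x in S, (beta x == beta z) ==> (phi x == h)]]].
  case/existsP=> z /andP[zS /existsP[h /forallP full]]; exists z => //.
  apply: (block_nbrs_fibre (h := h) qm degD redK le4) => x xS xz.
  by have := full x; rewrite xS xz eqxx => /eqP.
have {}nofull h z : z \in S -> exists x, [/\ x \in S, beta x = beta z & phi x != h].
  move=> zS; move: nofull; rewrite negb_exists => /forallP/(_ z).
  rewrite zS negb_exists => /forallP/(_ h); rewrite negb_forall => /existsP[x].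
  by rewrite !negb_imply => /and3P[xS /eqP xz xh]; exists x.
have le2 h : #|blocks beta [set x in S | phi x == h]| <= 2.
  exact: (card_fibre_blocks rI mono (nofull h)).
apply: (IH V e (fun x => fold_pair u v (phi x)) K D N beta S kK _ degD _ _ S0).
- exact: quotient_map_contraction.
- move=> x y xS yS lt; apply: mono => //; rewrite /r; lia.
(* The merged part meets at most two blocks through [u] and two through [v]: this is the origin of
   the bound 4. *)
- case=> [g|]; last first.
    apply: leq_trans (leq_add (le2 u) (le2 v)); apply: leq_trans (leq_card_setU _ _).1.
    apply: subset_leq_card; rewrite -imsetU; apply: imsetS; apply/subsetP=> x.
    by rewrite !inE => /andP[-> /eqP]; case: fold_pairP.
  apply: leq_trans (leq_trans (le2 (val g)) _) => //; apply: subset_leq_card.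
  apply: imsetS; apply/subsetP=> x; rewrite !inE => /andP[-> /eqP].
  by case: fold_pairP => // p [<-] /=.
Qed.

(** * Counting matrices with sparse coarsenings *)

Lemma half_ord_subproof (s : nat) (i : 'I_(2 ^ s.+1)) : i./2 < 2 ^ s.
Proof. by rewrite ltn_half_double -mul2n -expnS. Qed.

Definition half_ord (s : nat) (i : 'I_(2 ^ s.+1)) : 'I_(2 ^ s) :=
  Ordinal (half_ord_subproof i).

Definition coarsen (s : nat) (E : {set 'I_(2 ^ s.+1) * 'I_(2 ^ s.+1)}) :
    {set 'I_(2 ^ s) * 'I_(2 ^ s)} := [set (half_ord p.1, half_ord p.2) | p in E].

(** [E] itself is not bounded: only its successive coarsenings must have at most [c] entries per row
    on average. *)
Fixpoint sparse (c s : nat) : {set 'I_(2 ^ s) * 'I_(2 ^ s)} -> bool :=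
  if s is s'.+1 then fun E => (#|coarsen E| <= c * 2 ^ s') && sparse c (coarsen E)
  else xpredT.

(** A cell of [E'] splits into four finer cells, told apart by the parities of their indices, and
    [E] is a subset of these. *)
Lemma card_coarsen_fibre (s : nat) (E' : {set 'I_(2 ^ s) * 'I_(2 ^ s)}) :
  #|[set E | coarsen E == E']| <= 2 ^ (4 * #|E'|).
Proof.
pose P := [set p : 'I_(2 ^ s.+1) * 'I_(2 ^ s.+1) | (half_ord p.1, half_ord p.2) \in E'].
have sub : [set E | coarsen E == E'] \subset powerset P.
  apply/subsetP=> E; rewrite !inE => /eqP cE; apply/subsetP=> p pE.
  by rewrite inE -cE; apply/imsetP; exists p.
apply: leq_trans (subset_leq_card sub) _; rewrite card_powerset leq_exp2l //.
pose g (p : 'I_(2 ^ s.+1) * 'I_(2 ^ s.+1)) :=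
  ((half_ord p.1, half_ord p.2), (odd p.1, odd p.2)).
have gI : injective g.
  case=> [a b] [a' b'] [] Ea Eb Oa Ob; congr pair; apply: val_inj => /=.
    by rewrite -[LHS]odd_double_half -[RHS]odd_double_half Ea Oa.
  by rewrite -[LHS]odd_double_half -[RHS]odd_double_half Eb Ob.
rewrite -(card_imset _ gI).
have {}sub : [set g p | p in P] \subset setX E' [set: bool * bool].
  by apply/subsetP=> q /imsetP[p]; rewrite inE => pP ->; rewrite !inE pP.
apply: leq_trans (subset_leq_card sub) _.
by rewrite cardsX cardsT card_prod card_bool mulnC.
Qed.

(** Refining level [s] costs a factor [2 ^ (4 * c * 2 ^ s)]. The exponents form a geometric sum, and
    the leading 1 stands for the two matrices of size one. *)
Lemma card_sparse (c s : nat) :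
  #|[set E | @sparse c s E]| <= 2 ^ (1 + 4 * c * 2 ^ s).
Proof.
elim: s => [|s IHs].
  apply: leq_trans (max_card _) _; rewrite -cardsT -powersetT card_powerset cardsT.
  by rewrite card_prod !card_ord leq_exp2l.
pose Q := [set E' : {set 'I_(2 ^ s) * 'I_(2 ^ s)} | (#|E'| <= c * 2 ^ s) && sparse c E'].
have sub : [set E | @sparse c s.+1 E] \subset \bigcup_(E' in Q) [set E | coarsen E == E'].
  apply/subsetP=> E; rewrite inE => /= sE; apply/bigcupP; exists (coarsen E); rewrite inE //.
apply: leq_trans (subset_leq_card sub) _; apply: leq_trans (leq_card_bigcup _ _) _.
apply: (@leq_trans (\sum_(E' in Q) 2 ^ (4 * c * 2 ^ s))).
  apply: leq_sum => E'; rewrite inE => /andP[cE _].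
  by apply: leq_trans (card_coarsen_fibre _) _; rewrite leq_exp2l // -mulnA leq_mul2l cE orbT.
rewrite sum_nat_const expnS mul2n -addnn mulnDr addnA expnD leq_mul2r; apply/orP; right.
apply: leq_trans IHs; apply: subset_leq_card; apply/subsetP=> E.
by rewrite !inE => /andP[].
Qed.

Lemma coarsen_block_edges (V : finType) (e : rel V) (s : nat) 
    (beta : V -> 'I_(2 ^ s.+1)) (S : {set V}) :
  coarsen (block_edges e beta S) = block_edges e (fun x => half_ord (beta x)) S.
Proof. by rewrite /coarsen /block_edges -imset_comp; apply: eq_imset. Qed.

Lemma sparse_block_edges (V : finType) (e : rel V) (r : V -> nat) (c s : nat)
    (beta : V -> 'I_(2 ^ s)) :
  {homo beta : x y / r x < r y >-> (x <= y)%N} ->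
  (forall N (gamma : V -> 'I_N), {homo gamma : x y / r x < r y >-> (x <= y)%N} ->
     #|block_edges e gamma setT| <= c * #|blocks gamma setT|) ->
  sparse c (block_edges e beta setT).
Proof.
elim: s beta => //= s IHs beta mono sp; rewrite coarsen_block_edges.
have mono' : {homo (fun x => half_ord (beta x)) : x y / r x < r y >-> (x <= y)%N}.
  by move=> x y /mono h; apply: half_leq.
rewrite IHs // andbT; apply: leq_trans (sp _ _ mono') _.
by rewrite leq_mul2l; apply/orP; right; apply: leq_trans (max_card _) _; rewrite card_ord.
Qed.

Section Labelled.
Variables (D k : nat).
Let c := (4 * (k + D).+1).*2.

(** [pi] sorts the vertices by the order of the contraction sequence. The initial parts are single
    vertices, so each meets one block, within the bound 4 that [contraction_order] asks for. *)
Lemma tww_sparse (n s : nat) (ns : n <= 2 ^ s) (G : sgraph) (f : 'I_n -> G) :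
  bijective f -> (forall x : G, #|[pred y | adj x y]| <= D) ->
  (exists2 j, j <= k & full_contraction_sequence (trigraph_of_sgraph G) j) ->
  exists pi : {perm 'I_n},
    sparse c (block_edges (fun i j => adj (f i) (f j)) (fun i => widen_ord ns (pi i)) setT).
Proof.
move=> fbij degD [j0 j0k [H H1 cs]]; have [g fK gK] := fbij.
have [r rI rP] := contraction_order cs H1.
pose e i j := adj (f i) (f j).
pose rk i := #|[set j | r (f j) < r (f i)]|.
have rkn i : rk i < n.
  rewrite -[n in _ < n]card_ord -cardsT; apply: proper_card; rewrite properT.
  by apply/negP=> /eqP E; have := in_setT i; rewrite -E inE ltnn.
have rkM i j : r (f i) < r (f j) -> rk i < rk j.
  move=> lt; apply/proper_card/properP; split.
    by apply/subsetP=> l; rewrite !inE => /ltn_trans; apply.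
  by exists i; rewrite inE // ltnn.
have rkI : injective (fun i => Ordinal (rkn i)).
  move=> i j [E]; apply: (bij_inj fbij); apply: rI.
  by case: (ltngtP (r (f i)) (r (f j))) => // /rkM; rewrite E ltnn.
exists (perm rkI).
apply: (@sparse_block_edges _ _ (fun i => r (f i))) => [i j lt|N gamma mono].
  by rewrite /= !permE /= ltnW // rkM.
apply: card_block_edges => [i j|S S0]; first by rewrite adj_sym.
apply: (rP _ _ f) => //.
- split=> [h|i j eij|i j //]; first by exists (g h); rewrite gK.
  by constructor 2.
- move=> i; apply: leq_trans (degD (f i)); rewrite -(card_image (bij_inj fbij)).
  by apply: subset_leq_card; apply/subsetP=> y /imageP[j ej ->].
- by move=> i j _ _; apply: mono.
- move=> h; apply: (@leq_trans 1) => //.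
  apply: leq_trans (leq_imset_card _ _) _; apply/card_le1_eqP=> i j.
  rewrite !inE => /andP[_ /eqP fi] /andP[_ /eqP fj].
  by apply: (bij_inj fbij); rewrite fi fj.
Qed.

(** A matrix is recovered from its sorting permutation and a sparse set of cells, where [2 ^ s] is
    at most twice [n]. The case [n = 0] is kept apart because the empty graph has no contraction
    sequence ending at one vertex. *)
Lemma card_tww_labelled (n : nat) (L : {set 'M[bool]_n}) :
  (forall A, A \in L -> 0 < n -> exists G : sgraph,
     [/\ forall x : G, #|[pred y | adj x y]| <= D,
         exists2 j, j <= k & full_contraction_sequence (trigraph_of_sgraph G) j &
         exists2 f : 'I_n -> G, bijective f & forall i j, A i j = adj (f i) (f j)]) ->
  #|L| <= n`! * (2 ^ (1 + 8 * c)) ^ n.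
Proof.
move=> LP; have [n0|n0] := posnP n.
  by subst n; rewrite expn0 muln1; apply: leq_trans (max_card _) _; rewrite card_mx card_bool.
pose s := (trunc_log 2 n).+1.
have ns : n <= 2 ^ s by apply/ltnW/trunc_log_ltn.
have sn : 2 ^ s <= n.*2.
  by rewrite expnS mul2n leq_double; apply: trunc_logP.
pose dec (q : {perm 'I_n} * {set 'I_(2 ^ s) * 'I_(2 ^ s)}) : 'M[bool]_n :=
  (\matrix_(i, j) ((widen_ord ns (q.1 i), widen_ord ns (q.1 j)) \in q.2))%R.
have sub : L \subset [set dec q | q in setX setT [set E | @sparse c s E]].
  apply/subsetP=> A /LP/(_ n0)[G [degD tw [f fbij fA]]].
  have [pi piP] := tww_sparse ns fbij degD tw.
  apply/imsetP; eexists (pi, _); first by rewrite !inE /=; exact: piP.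
  apply/matrixP=> i j; rewrite mxE /= fA; apply/idP/imsetP => [eij|].
    by exists (i, j); rewrite // !inE.
  case=> [[i' j']]; rewrite !inE /= => eij [].
  by move=> /val_inj/perm_inj-> /val_inj/perm_inj->.
apply: leq_trans (subset_leq_card sub) _; apply: leq_trans (leq_imset_card _ _) _.
rewrite cardsX cardsT card_Sn leq_mul2l; apply/orP; right.
apply: leq_trans (card_sparse _ _) _; rewrite -expnM leq_exp2l //.
rewrite mulnDl mul1n leq_add //.
by rewrite (_ : 8 * c * n = 4 * c * n.*2); [rewrite leq_mul2l sn orbT|lia].
Qed.

End Labelled.

(** * Coloured complexes *)

(* A coloured complex given by its facets: [c i x] is the vertex of colour [i] of the facet
   [x], [rk] is the colour of a vertex, and [t i x] is the facet sharing with [x] all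
   vertices but that of colour [i]. *)
Record balanced (F V : finType) (d : nat) (rk : V -> nat) (c : nat -> F -> V)
    (t : nat -> F -> F) : Prop := Balanced {
  balanced_rk : forall i x, i <= d -> rk (c i x) = i;
  balanced_neq : forall i x, i <= d -> c i (t i x) != c i x;
  balanced_eq : forall i j x, i <= d -> j <= d -> j <> i -> c j (t i x) = c j x;
  balanced_thin : forall i x y, i <= d ->
    (forall j, j <= d -> j <> i -> c j y = c j x) -> y = x \/ y = t i x }.

Section BalancedComplex.
Variables (F V : finType) (d : nat) (rk : V -> nat) (c : nat -> F -> V) (t : nat -> F -> F).
Hypothesis bal : balanced d rk c t.

Lemma facet_inj (x y : F) : (forall j, j <= d -> c j y = c j x) -> y = x.
Proof.
move=> E; have [] // := balanced_thin bal (leq0n d) (fun j jd _ => E j jd).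
by move=> yt; have := balanced_neq bal x (leq0n d); rewrite -yt E ?eqxx.
Qed.

Lemma moveK (i : nat) : i <= d -> involutive (t i).
Proof.
move=> id x; have [|E|//] := @balanced_thin _ _ _ _ _ _ bal i (t i x) x id.
  by move=> j jd ji; rewrite (balanced_eq bal).
by have := balanced_neq bal x id; rewrite -E eqxx.
Qed.

Lemma move_inj (i j : nat) (x : F) : i <= d -> j <= d -> t i x = t j x -> i = j.
Proof.
move=> id jd E; case: (i =P j) => // ij; have := balanced_neq bal x id.
by rewrite E (balanced_eq bal) ?eqxx.
Qed.

Definition facet_set (x : F) : {set 'I_#|V|} := [set enum_rank (c i x) | i : 'I_d.+1].

Definition balanced_complex : {set {set 'I_#|V|}} :=
  [set s : {set 'I_#|V|} | (s != set0) && [exists x, s \subset facet_set x]].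

Lemma mem_facet_set (i : nat) (x : F) : i <= d -> enum_rank (c i x) \in facet_set x.
Proof. by move=> id; apply/imsetP; exists (Ordinal (id : i < d.+1)). Qed.

Lemma facet_setP (i : nat) (x y : F) :
  i <= d -> enum_rank (c i x) \in facet_set y -> c i x = c i y.
Proof.
move=> id /imsetP[j _ /enum_rank_inj E]; rewrite E.
by have := congr1 rk E; rewrite !(balanced_rk bal) -1?ltnS //= => ->.
Qed.

Lemma facet_set_inj : injective facet_set.
Proof.
move=> x y E; apply/esym/facet_inj => j jd; apply/esym/facet_setP => //.
by rewrite -E mem_facet_set.
Qed.

Lemma card_facet_set (x : F) : #|facet_set x| = d.+1.
Proof.
rewrite card_imset ?card_ord // => i j /enum_rank_inj/(congr1 rk).
by rewrite !(balanced_rk bal) -1?ltnS // => /val_inj.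
Qed.

Lemma simplicial_balanced_complex : simplicial_complex balanced_complex.
Proof.
split=> [|s u]; first by rewrite inE eqxx.
rewrite !inE => /andP[_ /existsP[x sx]] us ->; apply/existsP; exists x.
exact: subset_trans us sx.
Qed.

Definition facet_rel (x y : F) : bool := [exists i : 'I_d.+1, y == t i x].

Lemma facet_rel_sym : symmetric facet_rel.
Proof.
suff h x y : facet_rel x y -> facet_rel y x by move=> x y; apply/idP/idP; apply: h.
by case/existsP=> i /eqP ->; apply/existsP; exists i; rewrite moveK // -ltnS.
Qed.

Lemma facet_rel_irr : irreflexive facet_rel.
Proof.
move=> x; apply/existsP=> -[i /eqP E].
by have := @balanced_neq _ _ _ _ _ _ bal i x; rewrite -E -ltnS eqxx => /(_ (ltn_ord i)).
Qed.

Definition facet_graph : sgraph := SGraph facet_rel_sym facet_rel_irr.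

Lemma facet_graph_regular : regular d.+1 facet_graph.
Proof.
move=> x; rewrite -[RHS]card_ord -(card_image (f := fun i : 'I_d.+1 => t i x)).
  apply: eq_card => y; rewrite !inE; apply/existsP/imageP => [[i /eqP->]|[i _ ->]].
    by exists i.
  by exists i.
by move=> i j /move_inj E; apply/val_inj/E; rewrite -ltnS.
Qed.

(** A face with [d] vertices omits exactly one colour [i] of [x], and by thinness only [x] and
    [t i x] contain it. It is nonempty, hence a simplex, since [0 < d]. *)
Lemma facet_rel_share (x y : F) : 0 < d ->
  facet_rel x y = (x != y) &&
    [exists r in balanced_complex, [&& #|r| == d, r \subset facet_set x & r \subset facet_set y]].
Proof.
move=> d0; apply/idP/andP => [xy|[xy /existsP[r /and4P[_ /eqP cr rx ry]]]].
  split; first by apply: contraTneq xy => ->; rewrite facet_rel_irr.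
  case/existsP: xy => i /eqP ->; have id : i <= d by rewrite -ltnS.
  pose r := facet_set x :\ enum_rank (c i x).
  have cr : #|r| = d.
    have := cardsD1 (enum_rank (c i x)) (facet_set x).
    by rewrite mem_facet_set // card_facet_set => -[].
  have rx : r \subset facet_set x by apply: subD1set.
  apply/existsP; exists r; rewrite cr eqxx rx /=.
  apply/andP; split.
    rewrite inE; apply/andP; split; last by apply/existsP; exists x.
    by rewrite -card_gt0 cr.
  apply/subsetP=> w; rewrite 2!inE => /andP[wi /imsetP[j _ wj]].
  rewrite wj -(@balanced_eq _ _ _ _ _ _ bal i j x) ?mem_facet_set // -1?ltnS //.
  by move=> E; rewrite wj E eqxx in wi.
have /eqP : #|facet_set x :\: r| = 1.
  by rewrite cardsD (setIidPr rx) card_facet_set cr subSnn.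
case/cards1P=> a E; have : a \in facet_set x :\: r by rewrite E inE.
rewrite inE => /andP[_ /imsetP[i _ ai]]; apply/existsP; exists i.
have id : i <= d by rewrite -ltnS.
have [|yx|-> //] := @balanced_thin _ _ _ _ _ _ bal i x y id; last by rewrite yx eqxx in xy.
move=> j jd ji; apply/esym/facet_setP => //; apply: (subsetP ry).
apply: contraT => jr; have : enum_rank (c j x) \in facet_set x :\: r.
  by rewrite inE jr mem_facet_set.
rewrite E inE ai => /eqP/enum_rank_inj/(congr1 rk).
by rewrite !(balanced_rk bal) // => /ji.
Qed.

Lemma isomorphic_facet_graph : 0 < d -> isomorphic facet_graph (dual_graph d balanced_complex).
Proof.
move=> d0; have fP x : (facet_set x \in balanced_complex) && (#|facet_set x| == d.+1).
  rewrite card_facet_set eqxx andbT inE; apply/andP; split; last by apply/existsP; exists x.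
  by rewrite -card_gt0 card_facet_set.
pose f x : facet d balanced_complex := Sub (facet_set x) (fP x).
have fI : injective f by move=> x y /(congr1 val) /facet_set_inj.
have le : #|facet d balanced_complex| <= #|F|.
  rewrite -[leqLHS]cardsT -[leqRHS]cardsT.
  apply: leq_trans (subset_leq_card _) (leq_imset_card f [set: F]).
  apply/subsetP=> -[s sP] _; have /andP[] := sP.
  rewrite inE => /andP[_ /existsP[x sx]] /eqP cs.
  apply/imsetP; exists x => //; apply/val_inj/eqP => /=.
  by rewrite eqEcard sx card_facet_set cs leqnn.
exists f; first exact: inj_card_bij fI le.
by move=> x y; rewrite /= facet_rel_share // /facet_adj (inj_eq fI).
Qed.

End BalancedComplex.

(* The product with a 4-cycle whose vertices are pairs [(b, s)] of a colour and a sign: the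
   facets of the staircase subdivision of (d-simplex) x (edge) are indexed by the position [a]
   of the step along the edge. *)
Section CircleProduct.
Variables (F V : finType) (d : nat) (rk : V -> nat) (c : nat -> F -> V) (t : nat -> F -> F).

Definition prod_facet : finType := ('I_d.+1 * F * (bool * bool))%type.
Definition prod_vertex : finType := (V * (bool * bool))%type.

Definition prod_rk (w : prod_vertex) : nat := rk w.1 + w.2.1.

(** The staircase runs through the colours [0..a] of [x] over the end of the edge coloured [false],
    repeats the vertex of colour [a] over the other end, and continues there. *)
Definition prod_c (i : nat) (z : prod_facet) : prod_vertex :=
  let: (a, x, y) := z in
  if i <= a then (c i x, (false, y.1)) else (c i.-1 x, (true, y.2)).

(** Omitting a vertex at the step shifts the step by one. At [a = 0] or [a = d] that vertex may be
    the only one over its end, and then the end is replaced by the opposite vertex of the 4-cycle.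
    Any other omission is a move of [x]. *)
Definition prod_t (i : nat) (z : prod_facet) : prod_facet :=
  let: (a, x, y) := z in
  if i < a then (a, t i x, y)
  else if i == a then
    if a == 0 :> nat then (a, x, (~~ y.1, y.2)) else (inord a.-1, x, y)
  else if i == a.+1 then
    if a == d :> nat then (a, x, (y.1, ~~ y.2)) else (inord a.+1, x, y)
  else (a, t i.-1 x, y).

Hypothesis bal : balanced d rk c t.

(** For thinness: away from colour [i] the vertices of both facets lie over ends of the same colour,
    so the step stays or shifts by one; the rest is thinness of the factor. *)
Lemma balanced_prod : balanced d.+1 prod_rk prod_c prod_t.
Proof.
split.
- move=> i [[a x] y] id; rewrite /prod_c /prod_rk; have := ltn_ord a.
  case: (leqP i a) => ia /= ad; rewrite (balanced_rk bal); lia.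
- move=> i [[a x] [y0 y1]] id; have ad := ltn_ord a; rewrite /prod_t; apply/eqP.
  case: ltngtP => [ia|ai|ia].
  + by rewrite /prod_c ltnW // => -[]; apply/eqP/(balanced_neq bal); lia.
  + case: eqP => [ia|ia]; first case: eqP => [ad'|ad'].
    * by rewrite /prod_c ia ltnn => -[]; case: (y1).
    * by rewrite /prod_c ia inordK ?ltnn ?leqnn //; lia.
    rewrite /prod_c leqNgt ai => -[]; apply/eqP/(balanced_neq bal); lia.
  + case: eqP => a0; first by rewrite /prod_c ia leqnn => -[]; case: (y0).
    rewrite /prod_c ia leqnn inordK; last lia.
    by case: leqP => //; lia.
- move=> i j [[a x] [y0 y1]] id jd ji; have ad := ltn_ord a; rewrite /prod_t.
  case: ltngtP => [ia|ai|ia].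
  + rewrite /prod_c; case: leqP => ja; rewrite (balanced_eq bal) //; lia.
  + case: eqP => [ia|ia]; first case: eqP => [ad'|ad'].
    * by rewrite /prod_c; case: leqP => //=; lia.
    * rewrite /prod_c inordK; last lia.
      by case: (leqP j a) => ja; case: leqP => //; lia.
    rewrite /prod_c; case: leqP => ja; rewrite (balanced_eq bal) //; lia.
  + case: eqP => a0; first by rewrite /prod_c; case: leqP => //=; lia.
    rewrite /prod_c inordK; last lia.
    by case: (leqP j a) => ja; case: leqP => //; lia.
move=> i [[a x] [y0 y1]] [[a' x'] [y0' y1']] id E.
have ad := ltn_ord a; have ad' := ltn_ord a'.
have Ea j : j <= d.+1 -> j <> i -> (j <= a') = (j <= a).
  move=> jd ji; have := E j jd ji; rewrite /prod_c.
  by case: (leqP j a') => _; case: (leqP j a) => _.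
have Ec_le j : j <= a -> j <> i -> c j x' = c j x /\ y0' = y0.
  move=> ja ji; have jd : j <= d.+1 by lia.
  by have := E j jd ji; rewrite /prod_c Ea // ja => -[].
have Ec_gt j : a < j.+1 -> j <= d -> j.+1 <> i -> c j x' = c j x /\ y1' = y1.
  move=> ja jd ji; have := E j.+1 jd ji; rewrite /prod_c Ea //.
  by rewrite leqNgt ja /= => -[].
have xx' : (forall j, j <= d -> c j x' = c j x) -> x' = x by apply: (facet_inj bal).
rewrite /prod_t; case: (ltngtP a a') => aa.
- have ia : i = a.+1 by apply/eqP; apply: contraT => /eqP ia; have := Ea a.+1; lia.
  have aE : a' = a.+1 :> nat.
    by apply/eqP; apply: contraT => /eqP h; have := Ea a.+2; lia.
  right; rewrite ia ltnNge leqnSn /= eqn_leq ltnn /= eqxx.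
  have -> : (a == d :> nat) = false by lia.
  have -> : a' = inord a.+1 by apply: val_inj; rewrite /= inordK; lia.
  have -> : x' = x.
    apply: xx' => j jd; have [ja|ja] := leqP j a.
      by apply: (proj1 (Ec_le j _ _)); lia.
    by apply: (proj1 (Ec_gt j _ _ _)); lia.
  have -> : y0' = y0 by apply: (proj2 (Ec_le 0 _ _)); lia.
  by have -> : y1' = y1 by apply: (proj2 (Ec_gt d _ _ _)); lia.
- have ia : i = a.
    by apply/eqP; apply: contraT => /eqP ia; have := Ea a; lia.
  have aE : a = a'.+1 :> nat.
    by apply/eqP; apply: contraT => /eqP h; have := Ea a'.+1; lia.
  right; rewrite ia ltnn eqxx.
  have -> : (a == 0 :> nat) = false by lia.
  have -> : a' = inord a.-1 by apply: val_inj; rewrite /= inordK; lia.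
  have -> : x' = x.
    apply: xx' => j jd; have [ja|ja] := ltnP j a.
      by apply: (proj1 (Ec_le j _ _)); lia.
    by apply: (proj1 (Ec_gt j _ _ _)); lia.
  have -> : y0' = y0 by apply: (proj2 (Ec_le 0 _ _)); lia.
  by have -> : y1' = y1 by apply: (proj2 (Ec_gt d _ _ _)); lia.
have {aa} -> : a' = a by apply/esym/val_inj.
case: (ltngtP i a) => ia.
- have y0E : y0' = y0 by apply: (proj2 (Ec_le a _ _)); lia.
  have y1E : y1' = y1 by apply: (proj2 (Ec_gt d _ _ _)); lia.
  have [||->|->] := @balanced_thin _ _ _ _ _ _ bal i x x';
    rewrite ?y0E ?y1E; [lia| |by left|by right].
  move=> j jd ji; have [ja|ja] := leqP j a.
    by apply: (proj1 (Ec_le j _ _)); lia.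
  by apply: (proj1 (Ec_gt j _ _ _)); lia.
- have y0E : y0' = y0 by apply: (proj2 (Ec_le a _ _)); lia.
  have [ia1|ia1] := eqVneq i a.+1.
    have -> : x' = x.
      apply: xx' => j jd; have [ja|ja] := leqP j a.
        by apply: (proj1 (Ec_le j _ _)); lia.
      by apply: (proj1 (Ec_gt j _ _ _)); lia.
    have [aE|aE] := eqVneq (a : nat) d.
      by rewrite y0E; case: (y1) (y1') => -[]; by [left|right].
    left; rewrite y0E.
    by have -> : y1' = y1 by apply: (proj2 (Ec_gt d _ _ _)); lia.
  have y1E : y1' = y1 by apply: (proj2 (Ec_gt a _ _ _)); lia.
  have [||->|->] := @balanced_thin _ _ _ _ _ _ bal i.-1 x x';
    rewrite ?y0E ?y1E; [lia| |by left|by right].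
  move=> j jd ji; have [ja|ja] := leqP j a.
    by apply: (proj1 (Ec_le j _ _)); lia.
  by apply: (proj1 (Ec_gt j _ _ _)); lia.
have y1E : y1' = y1 by apply: (proj2 (Ec_gt d _ _ _)); lia.
have -> : x' = x.
  apply: xx' => j jd; have [ja|ja] := ltnP j a.
    by apply: (proj1 (Ec_le j _ _)); lia.
  by apply: (proj1 (Ec_gt j _ _ _)); lia.
have [a0|a0] := eqVneq (a : nat) 0.
  by rewrite y1E; case: (y0) (y0') => -[]; by [left|right].
left; rewrite y1E.
by have -> : y0' = y0 by apply: (proj2 (Ec_le 0 _ _)); lia.
Qed.

End CircleProduct.

(* For moves depending on a parameter [s]: a relabelling [f] of the facets and the parameter
   are determined by the relabelled moves [eta] and by the label of one facet. *)
Definition decodable (S F : Type) (d : nat) (t : S -> nat -> F -> F) (z : F) : Prop :=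
  forall (I : Type) (eta : nat -> I -> I) (f f' : F -> I) (s s' : S), injective f ->
    (forall i x, i <= d -> f (t s i x) = eta i (f x)) ->
    (forall i x, i <= d -> f' (t s' i x) = eta i (f' x)) ->
    f z = f' z -> s = s' /\ f =1 f'.

Section DecodableProduct.
Variables (S : Type) (F : finType) (d : nat) (t : S -> nat -> F -> F) (z : F).
Hypotheses (d0 : 0 < d) (dec : decodable d t z).

Lemma prod_t_lt s i (a : 'I_d.+1) x y : i < a -> prod_t (t s) i (a, x, y) = (a, t s i x, y).
Proof. by rewrite /prod_t => ->. Qed.

Lemma prod_t_gt s i (a : 'I_d.+1) x y :
  a.+1 < i -> prod_t (t s) i (a, x, y) = (a, t s i.-1 x, y).
Proof.
move=> ai; rewrite /prod_t ltnNge (ltnW (ltnW ai)) /=.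
by rewrite (gtn_eqF (ltnW ai)) (gtn_eqF ai).
Qed.

Lemma prod_t_down s (a b : 'I_d.+1) x y : b.+1 = a -> prod_t (t s) a (a, x, y) = (b, x, y).
Proof.
by move=> ba; rewrite /prod_t ltnn eqxx -ba /=; congr (_, _, _); apply: val_inj; rewrite /= inordK.
Qed.

Lemma prod_t_up s (a b : 'I_d.+1) x y : a.+1 = b -> prod_t (t s) b (a, x, y) = (b, x, y).
Proof.
move=> ab; have bd := ltn_ord b; rewrite /prod_t -ab ltnNge leqnSn /= eqn_leq ltnn /= eqxx.
rewrite (_ : (a == d :> nat) = false); last lia.
by congr (_, _, _); apply: val_inj; rewrite /= inordK ?ab.
Qed.

(** Shifting the step and changing an end of the edge do not depend on the parameter, so agreement
    spreads to all steps and edges; the slice of step [ord_max] decodes the factor. *)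
Lemma decodable_prod :
  decodable d.+1 (fun s => prod_t (d := d) (t s)) (ord_max : 'I_d.+1, z, (false, false)).
Proof.
move=> I eta f f' s s' fI fE f'E fz.
have down (a b : 'I_d.+1) x y :
    b.+1 = a -> f (a, x, y) = f' (a, x, y) -> f (b, x, y) = f' (b, x, y).
  move=> ba E; have ad := ltnW (ltn_ord a).
  by rewrite -{1}(prod_t_down s x y ba) fE // E -f'E // (prod_t_down s' x y ba).
have up (a b : 'I_d.+1) x y :
    a.+1 = b -> f (a, x, y) = f' (a, x, y) -> f (b, x, y) = f' (b, x, y).
  move=> ab E; have bd := ltnW (ltn_ord b).
  by rewrite -{1}(prod_t_up s x y ab) fE // E -f'E // (prod_t_up s' x y ab).
have line (a b : 'I_d.+1) x y : f (a, x, y) = f' (a, x, y) -> f (b, x, y) = f' (b, x, y).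
  move=> E; have E0 : f (ord0, x, y) = f' (ord0, x, y).
    case: a E => m md; elim: m md => [|m IH] md E.
      by rewrite (_ : ord0 = Ordinal md) //; apply: val_inj.
    by apply: (IH (ltnW md)); apply: down E.
  case: b => m md; elim: m md => [|m IH] md.
    by rewrite (_ : Ordinal md = ord0) //; apply: val_inj.
  by apply: up (IH (ltnW md)).
(* In the slice [a = d] the base move of colour [d] is not a product move, but a conjugate: shift
   the step down, move by colour [d.+1], shift back. *)
pose eta' i := if i < d then eta i else eta d \o eta d.+1 \o eta d.
pose dm : 'I_d.+1 := inord d.-1.
have dmE : dm.+1 = d by rewrite inordK ?prednK // ltnS leq_pred.
have conj s1 x y : prod_t (t s1) d (prod_t (t s1) d.+1 (prod_t (t s1) d (ord_max : 'I_d.+1, x, y)))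
    = (ord_max, t s1 d x, y).
  rewrite (@prod_t_down _ ord_max dm) // (@prod_t_gt s1 d.+1 dm) ?dmE //.
  by rewrite (@prod_t_up _ dm ord_max).
have slice y : f (ord_max, z, y) = f' (ord_max, z, y) ->
    s = s' /\ forall x, f (ord_max, x, y) = f' (ord_max, x, y).
  apply: (@dec I eta' (fun x => f (ord_max, x, y)) (fun x => f' (ord_max, x, y)) s s').
  - by move=> x x' /fI[].
  - move=> i x id; rewrite /eta'; case: ltnP => [lt|ge].
      by rewrite -fE ?prod_t_lt // ltnW.
    by have -> : i = d by [lia]; rewrite /= -!fE // conj.
  - move=> i x id; rewrite /eta'; case: ltnP => [lt|ge].
      by rewrite -f'E ?prod_t_lt // ltnW.
    by have -> : i = d by [lia]; rewrite /= -!f'E // conj.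
have full y : f (ord_max, z, y) = f' (ord_max, z, y) -> forall a x, f (a, x, y) = f' (a, x, y).
  by move=> /slice[_ E] a x; apply: line (E x).
have flip0 y : (forall a x, f (a, x, y) = f' (a, x, y)) ->
    forall a x, f (a, x, (~~ y.1, y.2)) = f' (a, x, (~~ y.1, y.2)).
  move=> E; apply: full; apply: (line ord0).
  have -> : (ord0 : 'I_d.+1, z, (~~ y.1, y.2)) = prod_t (t s) 0 (ord0, z, y) by [].
  by rewrite fE // E -f'E.
have flip1 y : (forall a x, f (a, x, y) = f' (a, x, y)) ->
    forall a x, f (a, x, (y.1, ~~ y.2)) = f' (a, x, (y.1, ~~ y.2)).
  move=> E; apply: full.
  have m s1 : (ord_max : 'I_d.+1, z, (y.1, ~~ y.2)) = prod_t (t s1) d.+1 (ord_max, z, y).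
    by rewrite /prod_t /= ltnNge leqnSn /= eqn_leq ltnn /= !eqxx.
  by rewrite {1}(m s) (m s') fE // f'E // E.
have [ss' _] := slice _ fz; split=> //.
have f00 := full _ fz; have f10 := flip0 _ f00; have f01 := flip1 _ f00; have f11 := flip1 _ f10.
by case=> [[a x] [[] []]] /=; [apply: f11|apply: f10|apply: f01|apply: f00].
Qed.

End DecodableProduct.

(** For [d = 2], the facets at [v] are the triangles on [v] and two cyclically consecutive entries
    of [s]. The length 4 is where the charts of [cycle_coneP] start. *)
Definition has_cyclic_link (F V : finType) (d : nat) (c : nat -> F -> V)
    (v : V) (s : seq V) : Prop :=
  let on w x := exists2 i, i <= d & c i x = w in
  [/\ 4 <= size s, uniq (v :: s),
      forall x, on v x -> exists2 i, i < size s &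
        forall l, l <= d -> c l x \in [:: v; nth v s i; nth v s (i.+1 %% size s)] &
      forall i, i < size s -> exists x,
        [/\ on v x, on (nth v s i) x & on (nth v s (i.+1 %% size s)) x]].

(** * Surfaces glued from hexagons *)

(* A closed surface made of hexagons, one for each element of [X * bool * bool]. The perimeter
   of a hexagon is subdivided into 12 arcs [h], joining the points [h] and [ordS h]; the
   points are the corners ([h] even) and the midpoints of the sides ([h] odd), and the facets
   are the triangles spanned by the centre and an arc. The sides are mirrors: three of them
   are glued by [swap k], the three others flip the last component. *)
Section HexSurface.
Variables (X : finType) (s : nat -> {perm X}).

Definition hexagon : finType := ((X * bool) * bool)%type.
Definition hex_facet : finType := (hexagon * 'I_12)%type.
Definition hex_vertex : finType := (option 'I_12 * hexagon)%type.

(** The permutation [s k] turned into a fixed-point-free involution, exchanging [(x, false)] and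
    [(s k x, true)]. *)
Definition swap (k : nat) (v : X * bool) : X * bool :=
  if v.2 then ((s k)^-1%g v.1, false) else (s k v.1, true).

(* A representative of the orbit of [v] under [swap k]. *)
Definition orbit_rep (k : nat) (v : X * bool) : X * bool :=
  if v.2 then ((s k)^-1%g v.1, false) else v.

(** A side consists of two arcs: [4k] and [4k+1] are glued by [swap k], [4k+2] and [4k+3] flip.
    Consecutive sides act on different components. *)
Definition mirror (h : nat) (z : hexagon) : hexagon :=
  if h %% 4 < 2 then (swap (h %/ 4) z.1, z.2) else (z.1, ~~ z.2).

(* A representative of the orbit of [z] under the mirrors through the point [h]. *)
Definition point_rep (h : nat) (z : hexagon) : hexagon :=
  (if h %% 4 == 3 then z.1 else orbit_rep (h %/ 4) z.1, (h %% 4 == 1) && z.2).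

Definition hex_point (h : 'I_12) (z : hexagon) : hex_vertex := (Some h, point_rep h z).
Definition hex_centre (z : hexagon) : hex_vertex := (None, z).

Definition hex_rk (w : hex_vertex) : nat := if w.1 is Some h then odd h else 2.

Definition hex_c (i : nat) (x : hex_facet) : hex_vertex :=
  if i == 2 then hex_centre x.1
  else if odd x.2 == odd i then hex_point x.2 x.1 else hex_point (ordS x.2) x.1.

Definition hex_t (i : nat) (x : hex_facet) : hex_facet :=
  if i == 2 then (mirror x.2 x.1, x.2)
  else if odd x.2 == odd i then (x.1, ordS x.2) else (x.1, ord_pred x.2).

Lemma swap_neq k v : swap k v != v.
Proof. by case: v => x []; rewrite /swap /= xpair_eqE andbC. Qed.

Lemma orbit_rep_swap k v : orbit_rep k (swap k v) = orbit_rep k v.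
Proof. by case: v => x []; rewrite /swap /orbit_rep /= ?permK. Qed.

Lemma orbit_repP k v w : orbit_rep k w = orbit_rep k v -> w = v \/ w = swap k v.
Proof.
case: v w => x [] [y []]; rewrite /orbit_rep /swap /= => -[].
- by move=> /perm_inj ->; left.
- by move=> ->; right.
- by move=> <-; right; rewrite permKV.
- by move=> ->; left.
Qed.

Lemma mirror_neq h z : mirror h z != z.
Proof.
case: z => v b; rewrite /mirror; case: ifP => _; rewrite xpair_eqE /= ?(negPf (swap_neq _ _)) //.
by case: b; rewrite andbF.
Qed.

Ltac arc_cases h := case: h => [[|[|[|[|[|[|[|[|[|[|[|[|//]]]]]]]]]]]] ?].

Lemma odd_ordS (h : 'I_12) : odd (ordS h) = ~~ odd h.
Proof. by arc_cases h. Qed.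

Lemma odd_ord_pred (h : 'I_12) : odd (ord_pred h) = ~~ odd h.
Proof. by arc_cases h. Qed.

Lemma ordSS_neq (h : 'I_12) : ordS (ordS h) != h.
Proof. by arc_cases h. Qed.

Lemma ordS_neq_pred (h : 'I_12) : ordS h != ord_pred h.
Proof. by arc_cases h. Qed.

Lemma mirror_ordS (h : 'I_12) : ~~ odd h -> mirror (ordS h) = mirror h.
Proof. by arc_cases h. Qed.

Lemma mirror_ord_pred (h : 'I_12) : odd h -> mirror (ord_pred h) = mirror h.
Proof. by arc_cases h. Qed.

Lemma point_rep_mirror (h : 'I_12) z :
  point_rep h (mirror h z) = point_rep h z /\
  point_rep (ordS h) (mirror h z) = point_rep (ordS h) z.
Proof.
by arc_cases h; rewrite /point_rep /mirror /= /modn /divn /= ?orbit_rep_swap.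
Qed.

Ltac arc_solve :=
  match goal with
  | H : orbit_rep _ _ = orbit_rep _ _, H' : ?b' = ?b |- context [(?v, ?b)] =>
    rewrite H'; case: (orbit_repP H) => ->; by [left | right]
  | H : ?v' = ?v |- context [(?v, ~~ ?b)] =>
    rewrite H; match goal with |- context [(v, ?b')] =>
      by case: (b) (b') => -[]; by [left | right]
    end
  end.

Lemma arc_repP (h : 'I_12) z w :
  point_rep h w = point_rep h z -> point_rep (ordS h) w = point_rep (ordS h) z ->
  w = z \/ w = mirror h z.
Proof.
case: z w => [v b] [v' b'] E1 E2.
move: (congr1 fst E1) (congr1 snd E1) (congr1 fst E2) (congr1 snd E2) => {E1 E2}.
by arc_cases h; rewrite /point_rep /mirror /= => ? ? ? ?; arc_solve.
Qed.

Lemma side_repP (h : 'I_12) z w : odd h ->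
  point_rep h w = point_rep h z -> w = z \/ w = mirror h z.
Proof.
case: z w => [v b] [v' b'] hh E1; move: hh.
move: (congr1 fst E1) (congr1 snd E1) => {E1}.
by arc_cases h; rewrite /point_rep /mirror //= => ? ? ?; arc_solve.
Qed.

Lemma corner_repP (h : 'I_12) z w : ~~ odd h ->
  point_rep h w = point_rep h z ->
  w \in [:: z; mirror h z; mirror (ord_pred h) (mirror h z); mirror (ord_pred h) z].
Proof.
case: z w => [v b] [v' b'] hh E1; rewrite !inE; move: hh.
move: (congr1 fst E1) => {E1}.
by arc_cases h; rewrite /point_rep /mirror //= => E _;
  case: (orbit_repP E) => ->; case: (b) (b') => -[]; rewrite ?eqxx ?orbT.
Qed.

Lemma mirrorC (h : 'I_12) z : ~~ odd h ->
  mirror h (mirror (ord_pred h) z) = mirror (ord_pred h) (mirror h z).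
Proof. by case: z => v b; arc_cases h. Qed.

Lemma uniq_corner_mirrors (h : 'I_12) z : ~~ odd h ->
  uniq [:: z; mirror h z; mirror (ord_pred h) (mirror h z); mirror (ord_pred h) z].
Proof.
have sw k v : (v == swap k v) = false by rewrite eq_sym; apply/negbTE/swap_neq.
have ws k v : (swap k v == v) = false by apply/negbTE/swap_neq.
case: z => v b; rewrite /= !inE.
by arc_cases h; rewrite /mirror //= !xpair_eqE ?sw ?ws; case: (b); rewrite ?andbF.
Qed.

Lemma hex_c_lo z (h : 'I_12) : hex_c (odd h) (z, h) = hex_point h z.
Proof. by rewrite /hex_c; case: (odd h). Qed.

Lemma hex_c_hi z (h : 'I_12) : hex_c (~~ odd h) (z, h) = hex_point (ordS h) z.
Proof. by rewrite /hex_c; case: (odd h). Qed.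

Lemma balanced_hex : balanced 2 hex_rk hex_c hex_t.
Proof.
have i2 i : i <= 2 -> i != 2 -> (i == odd i :> nat) by case: i => [|[|[]]].
split.
- move=> i x id; rewrite /hex_c; case: eqVneq => [->//|/(i2 _ id)/eqP iE].
  case: (eqVneq (odd x.2) (odd i)) => [E|]; rewrite /hex_rk /=; first by rewrite E.
  by rewrite odd_ordS {2}iE; case: (odd x.2) (odd i) => -[].
- move=> i [z h] id; rewrite /hex_c /hex_t /=; case: (eqVneq i 2) => [_|_] /=.
    by rewrite /hex_centre xpair_eqE mirror_neq.
  case: (eqVneq (odd h) (odd i)) => [E|E] /=.
    by rewrite odd_ordS E; case: (odd i); rewrite /hex_point
      xpair_eqE /= (inj_eq (@Some_inj _)) (negPf (ordSS_neq h)).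
  rewrite odd_ord_pred ifT; last by case: (odd h) (odd i) E => -[].
  by rewrite /hex_point xpair_eqE (inj_eq (@Some_inj _)) eq_sym (negPf (ordS_neq_pred h)).
- move=> i j [z h] id jd ji; rewrite /hex_c /hex_t /=; case: (eqVneq i 2) => [iE|i'] /=.
    have [E1 E2] := point_rep_mirror h z.
    by case: (eqVneq j 2) => [jE|_]; [case: ji; rewrite jE|rewrite /hex_point E1 E2].
  case: (eqVneq j 2) => [_|j'] /=; first by case: (odd h == odd i).
  have odd_ij : odd j = ~~ odd i.
    by case: i j id jd ji i' j' => [|[|[|?]]] [|[|[|?]]].
  case: (eqVneq (odd h) (odd i)) => [E|E] /=.
    by rewrite odd_ordS E odd_ij eqxx; case: (odd i).
  by rewrite odd_ord_pred odd_ij ord_predK; case: (odd h) (odd i) E => -[].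
move=> i [z h] [w h'] id E; rewrite /hex_t /=; case: (eqVneq i 2) => [iE|i'].
  have Elo := E (odd h) _ _; have Ehi := E (~~ odd h) _ _.
  rewrite hex_c_lo in Elo; rewrite hex_c_hi in Ehi.
  have {}Elo : hex_c (odd h) (w, h') = hex_point h z by apply: Elo; rewrite ?iE; case: (odd h).
  have {}Ehi : hex_c (~~ odd h) (w, h') = hex_point (ordS h) z.
    by apply: Ehi; rewrite ?iE; case: (odd h).
  (* Two arcs with the same endpoints coincide, the perimeter having more than two arcs. *)
  have hh : h' = h.
    case: (eqVneq (odd h) (odd h')) => [oh|oh]; first by move: Elo; rewrite oh hex_c_lo => -[].
    have oh' : odd h = ~~ odd h' by case: (odd h) (odd h') oh => -[].
    move: Elo Ehi; rewrite oh' hex_c_hi negbK hex_c_lo => /(congr1 fst)[E1] /(congr1 fst)[E2].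
    by have := ordSS_neq h'; rewrite E1 E2 eqxx.
  subst h'; move: Elo Ehi; rewrite hex_c_lo hex_c_hi => /(congr1 snd) E1 /(congr1 snd) E2.
  by case: (arc_repP E1 E2) => ->; [left|right].
have wz : w = z.
  have /(congr1 snd) // : hex_c 2 (w, h') = hex_c 2 (z, h).
  by apply: E => //; apply/eqP; rewrite eq_sym.
subst w; have /eqP iE := i2 i id i'.
have {}E : hex_c (~~ odd i) (z, h') = hex_c (~~ odd i) (z, h).
  by apply: E; [case: (odd i)|move: iE; case: (odd i) => /= ->].
have negb_neq (a b : bool) : a != b -> a = ~~ b by case: a b => -[].
case: (eqVneq (odd h) (odd i)) E => [<-|/negb_neq oh].
  rewrite hex_c_hi; case: (eqVneq (odd h) (odd h')) => [->|/negb_neq ->].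
    by rewrite hex_c_hi => /(congr1 fst)/Some_inj/(can_inj (@ordSK _)) ->; left.
  by rewrite negbK hex_c_lo => /(congr1 fst)/Some_inj ->; right.
rewrite -oh hex_c_lo; case: (eqVneq (odd h) (odd h')) => [->|/negb_neq ->].
  by rewrite hex_c_lo => /(congr1 fst)/Some_inj ->; left.
by rewrite hex_c_hi => /(congr1 fst)/Some_inj <-; rewrite ordSK; right.
Qed.

Definition triangle (z : hexagon) (h : 'I_12) : seq hex_vertex :=
  [:: hex_centre z; hex_point h z; hex_point (ordS h) z].

Lemma hex_c_triangle i z h : i <= 2 -> hex_c i (z, h) \in triangle z h.
Proof.
move=> id; rewrite /hex_c /triangle !inE /=.
by case: ifP => _; [|case: ifP => _]; rewrite eqxx ?orbT.
Qed.

Lemma arc_neq (h : 'I_12) :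
  ((h == ordS h) = false) * ((h == ord_pred h) = false) *
  ((ordS h == ord_pred h) = false) * ((ord_pred h == ordS h) = false).
Proof. by arc_cases h. Qed.

Lemma triangleP w z h : reflect (exists2 i, i <= 2 & hex_c i (z, h) = w) (w \in triangle z h).
Proof.
apply: (iffP idP) => [|[i id <-]]; last exact: hex_c_triangle.
rewrite !inE => /or3P[] /eqP->; first by exists 2.
  by exists (odd h : nat); [case: (odd h)|rewrite hex_c_lo].
by exists (~~ odd h : nat); [case: (odd h)|rewrite hex_c_hi].
Qed.

Lemma cyclic_triangles v u : 4 <= size u -> uniq (v :: u) ->
  (forall z h, v \in triangle z h -> exists2 i, i < size u &
     all [in [:: v; nth v u i; nth v u (i.+1 %% size u)]] (triangle z h)) ->
  (forall i, i < size u -> exists z h,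
     all [in triangle z h] [:: v; nth v u i; nth v u (i.+1 %% size u)]) ->
  has_cyclic_link 2 hex_c v u.
Proof.
move=> u4 uu sub sup; split=> // [[z h] /triangleP/sub[i iu /allP al]|i /sup[z [h]]].
  by exists i => // l l2; apply: al; apply: hex_c_triangle.
by case/and4P=> h1 h2 h3 _; exists (z, h); split; apply/triangleP.
Qed.

Lemma hex_point_eq a b z w :
  (hex_point a z == hex_point b w) = (a == b) && (point_rep a z == point_rep b w).
Proof. by rewrite /hex_point xpair_eqE (inj_eq (@Some_inj _)). Qed.

Lemma hex_centre_eq z w : (hex_centre z == hex_centre w) = (z == w).
Proof. by rewrite /hex_centre xpair_eqE eqxx. Qed.

Lemma hex_point_centre a z w : (hex_point a z == hex_centre w) = false.
Proof. by rewrite /hex_point /hex_centre xpair_eqE. Qed.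

Lemma hex_point_mirror (h : 'I_12) z : hex_point h (mirror h z) = hex_point h z.
Proof. by rewrite /hex_point; have [->] := point_rep_mirror h z. Qed.

Lemma hex_pointS_mirror (h : 'I_12) z : hex_point (ordS h) (mirror h z) = hex_point (ordS h) z.
Proof. by rewrite /hex_point; have [_ ->] := point_rep_mirror h z. Qed.

Lemma centre_link z :
  has_cyclic_link 2 hex_c (hex_centre z) [seq hex_point a z | a <- enum 'I_12].
Proof.
set v := hex_centre z; set u := map _ _.
have su : size u = 12 by rewrite size_map size_enum_ord.
have nthu (h : 'I_12) : nth v u h = hex_point h z.
  by rewrite (nth_map h) ?size_enum_ord // nth_ord_enum.
have nthuS (h : 'I_12) : nth v u (h.+1 %% 12) = hex_point (ordS h) z by rewrite -nthu.
apply: cyclic_triangles; rewrite ?su //.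
- rewrite /= map_inj_uniq ?enum_uniq ?andbT; last by move=> a b /(congr1 fst)/Some_inj.
  by apply/mapP=> -[a _] /(congr1 fst).
- move=> w h; rewrite !inE hex_centre_eq !orbF => /eqP<-; exists h => //.
  by rewrite nthu nthuS /= !inE !eqxx ?orbT.
- move=> i i12; exists z, (Ordinal i12).
  have /= -> := nthu (Ordinal i12); have /= -> := nthuS (Ordinal i12).
  by rewrite !inE !eqxx ?orbT.
Qed.

Lemma side_link (a : 'I_12) z : odd a ->
  has_cyclic_link 2 hex_c (hex_point a z)
    [:: hex_centre z; hex_point (ordS a) z; hex_centre (mirror a z); hex_point (ord_pred a) z].
Proof.
move=> oa; have m1 := hex_point_mirror a z; have m2 := hex_pointS_mirror a z.
have m3 : hex_point (ord_pred a) (mirror a z) = hex_point (ord_pred a) z.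
  by rewrite -[X in mirror X]/(nat_of_ord a) -mirror_ord_pred // hex_point_mirror.
apply: cyclic_triangles => //.
- have zm : (z == mirror a z) = false by rewrite eq_sym; apply/negbTE/mirror_neq.
  by rewrite /= !inE !hex_point_eq hex_centre_eq !arc_neq zm.
- move=> w h; rewrite !inE hex_point_centre !hex_point_eq orFb => /orP[]/andP[/eqP ah].
    subst h; move/eqP/esym/(side_repP oa); case=> ->; [exists 0 | exists 1] => //=;
    by rewrite ?m1 ?m2 ?m3 !inE !eqxx ?orbT.
  have {}ah : h = ord_pred a by rewrite ah ordSK.
  subst h; rewrite ord_predK => /eqP/esym/(side_repP oa); case=> ->; [exists 3 | exists 2] => //=;
  by rewrite ?ord_predK ?m1 ?m2 ?m3 !inE !eqxx ?orbT.
- case=> [|[|[|[|//]]]] _.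
  + by exists z, a; rewrite /= !inE !eqxx ?orbT.
  + by exists (mirror a z), a; rewrite /= /triangle m1 m2 !inE !eqxx ?orbT.
  + by exists (mirror a z), (ord_pred a); rewrite /= /triangle ord_predK m1 m3 !inE !eqxx ?orbT.
  + by exists z, (ord_pred a); rewrite /= /triangle ord_predK !inE !eqxx ?orbT.
Qed.

(** The hexagons around the corner are [z], [z1], [z2], [z3] in this order. Consecutive ones share a
    midpoint, and the circuit closes because the two mirrors commute. *)
Lemma corner_link (a : 'I_12) z : ~~ odd a ->
  let z1 := mirror a z in let z2 := mirror (ord_pred a) z1 in let z3 := mirror (ord_pred a) z in
  has_cyclic_link 2 hex_c (hex_point a z)
    [:: hex_centre z; hex_point (ordS a) z; hex_centre z1; hex_point (ord_pred a) z1;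
        hex_centre z2; hex_point (ordS a) z2; hex_centre z3; hex_point (ord_pred a) z3].
Proof.
move=> oa z1 z2 z3.
have p1 : hex_point a z1 = hex_point a z by apply: hex_point_mirror.
have mp w : hex_point a (mirror (ord_pred a) w) = hex_point a w.
  by have := hex_pointS_mirror (ord_pred a) w; rewrite ord_predK.
have p3 : hex_point a z3 = hex_point a z by apply: mp.
have p2 : hex_point a z2 = hex_point a z by rewrite mp.
have s1 : hex_point (ordS a) z1 = hex_point (ordS a) z by apply: hex_pointS_mirror.
have s3 : hex_point (ordS a) z3 = hex_point (ordS a) z2.
  by rewrite /z2 /z1 -mirrorC // hex_pointS_mirror.
have q2 : hex_point (ord_pred a) z2 = hex_point (ord_pred a) z1 by apply: hex_point_mirror.
have q3 : hex_point (ord_pred a) z3 = hex_point (ord_pred a) z by apply: hex_point_mirror.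
have uz := uniq_corner_mirrors z oa; rewrite -/z1 -/z2 -/z3 in uz.
have oS : odd (ordS a) by rewrite odd_ordS oa.
have oP : odd (ord_pred a) by rewrite odd_ord_pred oa.
apply: cyclic_triangles => //.
- have sz : point_rep (ordS a) z != point_rep (ordS a) z2.
    apply/eqP=> /esym/(side_repP oS); rewrite mirror_ordS // -/z1.
    by case=> E; move: uz; rewrite E /= !inE eqxx ?orbT /= ?andbF.
  have qz : point_rep (ord_pred a) z1 != point_rep (ord_pred a) z3.
    apply/eqP=> /esym/(side_repP oP); rewrite -/z2.
    by case=> E; move: uz; rewrite E /= !inE eqxx ?orbT /= ?andbF.
  move: uz; rewrite /= !inE !hex_point_eq !hex_centre_eq !negb_or.
  rewrite (negPf sz) (negPf qz) !arc_neq /= ?andbF ?andbT.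
  by case/and3P=> /and3P[-> -> ->] /andP[-> ->] ->.
- move=> w h; rewrite !inE hex_point_centre !hex_point_eq orFb => /orP[]/andP[/eqP ah].
    subst h; move/eqP/esym/(corner_repP oa); rewrite !inE => /or4P[] /eqP->;
    [exists 0 | exists 1 | exists 4 | exists 5] => //=;
    by rewrite -?/z1 -?/z2 -?/z3 ?p1 ?p2 ?p3 ?s1 ?s3 !inE !eqxx ?orbT.
  have {}ah : h = ord_pred a by rewrite ah ordSK.
  subst h; rewrite ord_predK => /eqP/esym/(corner_repP oa); rewrite !inE => /or4P[] /eqP->;
  [exists 7 | exists 2 | exists 3 | exists 6] => //=;
  by rewrite -?/z1 -?/z2 -?/z3 ?ord_predK ?p1 ?p2 ?p3 ?q2 ?q3 !inE !eqxx ?orbT.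
- case=> [|[|[|[|[|[|[|[|//]]]]]]]] _.
  + by exists z, a; rewrite /= !inE !eqxx ?orbT.
  + by exists z1, a; rewrite /= /triangle p1 s1 !inE !eqxx ?orbT.
  + by exists z1, (ord_pred a); rewrite /= /triangle ord_predK p1 !inE !eqxx ?orbT.
  + by exists z2, (ord_pred a); rewrite /= /triangle ord_predK p2 q2 !inE !eqxx ?orbT.
  + by exists z2, a; rewrite /= /triangle p2 !inE !eqxx ?orbT.
  + by exists z3, a; rewrite /= /triangle p3 s3 !inE !eqxx ?orbT.
  + by exists z3, (ord_pred a); rewrite /= /triangle ord_predK p3 !inE !eqxx ?orbT.
  + by exists z, (ord_pred a); rewrite /= /triangle ord_predK q3 !inE !eqxx ?orbT.
Qed.

Lemma hex_vertex_link i x : i <= 2 -> exists u, has_cyclic_link 2 hex_c (hex_c i x) u.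
Proof.
case: x => z h id; have : hex_c i (z, h) \in triangle z h by apply: hex_c_triangle.
have pl a : exists u, has_cyclic_link 2 hex_c (hex_point a z) u.
  by case: (boolP (odd a)) => [/side_link|/corner_link] L; eexists; apply: L.
by rewrite !inE => /or3P[]/eqP->; [eexists; apply: centre_link|apply: pl|apply: pl].
Qed.

End HexSurface.

(** [swap 0] joins [(x, false)] to [(x, true)], and [swap 1], thanks to the inverse, joins
    [(x, true)] to [(ordS x, false)]; these two reach everything without [sigma]. *)
Definition hex_perms (n : nat) (sigma : {perm 'I_n.+1}) (k : nat) : {perm 'I_n.+1} :=
  match k with 0 => 1%g | 1 => ((perm (@ordS_inj n.+1))^-1)%g | _ => sigma end.

Lemma val_iter_ordS n k (i : 'I_n.+1) : val (iter k (@ordS n.+1) i) = (i + k) %% n.+1.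
Proof.
elim: k => [|k IH] /=; first by rewrite addn0 modn_small.
by rewrite IH -addn1 modnDml addn1 addnS.
Qed.

Lemma decodable_hex (n : nat) :
  decodable 2 (fun sigma => hex_t (hex_perms (n := n) sigma)) (((ord0, false), false), ord0).
Proof.
move=> I eta f f' s s' fI fE f'E f0; pose t (sigma : {perm 'I_n.+1}) := hex_t (hex_perms sigma).
have step i x y : i <= 2 -> t s i x = y -> t s' i x = y -> f x = f' x -> f y = f' y.
  by move=> id ty t'y E; rewrite -{1}ty -t'y /t fE // E f'E.
(* The moves of colours 0 and 1 go round the perimeter of one hexagon. *)
have walk z h h' : f (z, h) = f' (z, h) -> f (z, h') = f' (z, h').
  move=> E; have iterE k : f (z, iter k (@ordS _) h) = f' (z, iter k (@ordS _) h).
    elim: k => //= k; apply: (step (odd (iter k (@ordS 12) h)) (z, _)); first by case: (odd _).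
      by rewrite /t /hex_t /=; case: (odd _).
    by rewrite /t /hex_t /=; case: (odd _).
  have <- : iter (h' + 12 - h) (@ordS _) h = h'; last exact: iterE.
  by apply: val_inj; rewrite val_iter_ordS; case: h h' {E iterE} => [h hl] [h' hl'] /=; lia.
have full v : f (v, false, ord0) = f' (v, false, ord0) -> forall b h, f (v, b, h) = f' (v, b, h).
  move=> E b h; have E' := walk _ _ _ E.
  case: b; last exact: E'.
  (* Arcs 0, 4 and 8 lie on the sides of [swap 0], [swap 1] and [swap 2]; arc 2 lies on a flipping
     side. *)
  apply: (walk _ (inord 2)); apply: (step 2 (v, false, inord 2)) (E' _) => //.
    by rewrite /t /hex_t /mirror /= inordK.
  by rewrite /t /hex_t /mirror /= inordK.
have f00 : f (ord0, false, false, ord0) = f' (ord0, false, false, ord0) by exact: f0.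
have flip x b : f (x, b, false, ord0) = f' (x, b, false, ord0) ->
    f (x, ~~ b, false, ord0) = f' (x, ~~ b, false, ord0).
  by apply: (step 2) => //; case: b => //=; rewrite /t /hex_t /mirror /= /swap /= ?invg1 perm1.
have shift x : f (x, true, false, ord0) = f' (x, true, false, ord0) ->
    f (ordS x, false, false, ord0) = f' (ordS x, false, false, ord0).
  move=> E; apply: (walk _ (inord 4)).
  apply: (step 2 (x, true, false, inord 4)) (full _ E _ _) => //.
    by rewrite /t /hex_t /mirror /= inordK //= /swap /= invgK permE.
  by rewrite /t /hex_t /mirror /= inordK //= /swap /= invgK permE.
have base x : f (x, false, false, ord0) = f' (x, false, false, ord0).
  have -> : x = iter x (@ordS n.+1) ord0.
    by apply: val_inj; rewrite val_iter_ordS add0n modn_small.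
  elim: (x : nat) => //= m /(flip _ false) /= E; exact: shift E.
have all x b eps h : f (x, b, eps, h) = f' (x, b, eps, h).
  by apply: full; case: b => //; apply: (flip x false).
split; last by case=> [[[x b] eps] h].
(* Across arc 8 lies the hexagon of the image of [x]. Its label is the same for both parameters, and
   [f] is injective. *)
apply/permP=> x; have : f (s x, true, false, inord 8) = f (s' x, true, false, inord 8).
  have m s1 : t s1 2 (x, false, false, inord 8) = (s1 x, true, false, inord 8).
    by rewrite /t /hex_t /mirror /= inordK.
  by rewrite -m /t fE // all -f'E // -/(t s' 2 _) m all.
by move/fI=> [].
Qed.

(** * Counting labelled graphs *)

(* A labelled facet graph, the list position of every neighbour and the label of one facet
   determine both the parameter and the labelling. *)
Lemma card_labelled_facet_graphs (S F V : finType) (d : nat) (rk : V -> nat)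
    (c : S -> nat -> F -> V) (t : S -> nat -> F -> F) (z : F) (L : {set 'M[bool]_#|F|}) :
  (forall s, balanced d rk (c s) (t s)) -> decodable d t z ->
  (forall s (f : 'I_#|F| -> F), bijective f ->
     (\matrix_(i, j) facet_rel d (t s) (f i) (f j))%R \in L) ->
  (#|S| * (#|F|)`! <= #|L| * ((d.+1 ^ d.+1) ^ #|F| * #|F|))%N.
Proof.
move=> bal dec LP; pose N := #|F|.
pose lab (p : {perm 'I_N}) (i : 'I_N) : F := enum_val (p i).
pose unlab (p : {perm 'I_N}) (x : F) : 'I_N := (p^-1)%g (enum_rank x).
have labK p : cancel (lab p) (unlab p) by move=> i; rewrite /unlab /lab enum_valK permK.
have unlabK p : cancel (unlab p) (lab p) by move=> x; rewrite /unlab /lab permKV enum_rankK.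
pose A (q : S * {perm 'I_N}) : 'M[bool]_N :=
  (\matrix_(i, j) facet_rel d (t q.1) (lab q.2 i) (lab q.2 j))%R.
pose nbrs (M : 'M[bool]_N) i := enum [pred j | M i j].
(* For each label and colour, the place of that neighbour in the list of neighbours: this costs
   [d.+1 ^ d.+1] per facet. The last factor [#|F|] of the bound is the label of [z]. *)
pose pos (q : S * {perm 'I_N}) : {ffun 'I_N -> {ffun 'I_d.+1 -> 'I_d.+1}} :=
  [ffun i : 'I_N => [ffun k : 'I_d.+1 =>
    inord (index (unlab q.2 (t q.1 k (lab q.2 i))) (nbrs (A q) i))]].
pose enc q := (A q, (pos q, unlab q.2 z)).
pose eta (M : 'M[bool]_N) (nu : {ffun 'I_N -> {ffun 'I_d.+1 -> 'I_d.+1}}) (k : nat) (i : 'I_N) :=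
  nth i (nbrs M i) (nu i (inord k)).
have etaP q k x : (k <= d)%N -> unlab q.2 (t q.1 k x) = eta (A q) (pos q) k (unlab q.2 x).
  move=> kd; have kE : (inord k : 'I_d.+1) = k :> nat by rewrite inordK.
  rewrite /eta /pos !ffunE unlabK kE.
  have mem : unlab q.2 (t q.1 k x) \in nbrs (A q) (unlab q.2 x).
    rewrite mem_enum inE mxE !unlabK; apply/existsP; exists (Ordinal (kd : (k < d.+1)%N)).
    by rewrite /=.
  have sz : size (nbrs (A q) (unlab q.2 x)) = d.+1.
    rewrite -cardE -(@facet_graph_regular _ _ _ _ _ _ (bal q.1) x).
    rewrite -(card_image (can_inj (labK q.2))); apply: eq_card => y; rewrite !inE.
    apply/imageP/idP => [[j]|xy].
      by rewrite inE mxE unlabK => xj ->.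
    by exists (unlab q.2 y); rewrite ?inE ?mxE !unlabK.
  by rewrite inordK ?nth_index // -sz index_mem.
have encI : injective enc.
  move=> q q' [EA Epos Ez].
  have [|k x kd|k x kd|//|E1 E2] := dec _ (eta (A q) (pos q)) (unlab q.2) (unlab q'.2) q.1 q'.1.
  - exact: can_inj (unlabK q.2).
  - exact: etaP.
  - by rewrite EA Epos; exact: etaP.
  case: q q' E1 E2 {EA Epos Ez} => [s p] [s' p'] /= -> E2; congr pair.
  apply: invg_inj; apply/permP => i; have := E2 (enum_val i).
  by rewrite /unlab enum_valK.
have sub : [set enc q | q : S * {perm 'I_N}] \subset setX L setT.
  apply/subsetP => y /imsetP[q _ ->]; rewrite !inE andbT.
  by apply: LP; exists (unlab q.2); [exact: labK|exact: unlabK].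
have := subset_leq_card sub.
rewrite card_imset // cardsX cardsT !card_prod !card_ffun !card_ord.
by rewrite -cardsT card_Sn.
Qed.

(** * Existence of contraction sequences and growth of factorials *)

Lemma card_contraction (H : trigraph) (u v : H) : u != v -> (#|contraction u v|.+1 = #|H|)%N.
Proof.
move=> uv; rewrite card_option card_sig -[RHS](cardC [pred x | (x != u) && (x != v)]).
rewrite addnC -addn2 addnC; congr (_ + _)%N.
rewrite -[LHS](_ : #|pred2 u v| = 2); last by rewrite card2 uv.
by apply: eq_card => x; rewrite !inE negb_and !negbK.
Qed.

Lemma exists_full_contraction_sequence (H : trigraph) :
  (0 < #|H|)%N -> exists k, full_contraction_sequence H k.
Proof.
have [n] := ubnP #|H|; elim: n H => // n IH H; rewrite ltnS => Hn H0.
have [H1|] := leqP #|H| 1.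
  exists (max_red_degree H), H; last exact: ContractionSequence0.
  by apply/eqP; rewrite eqn_leq H1.
case/card_gt1P=> u [v [_ _ uv]]; have cuv := card_contraction uv.
have [||k [H' H'1 cs]] := IH (contraction u v); first by rewrite cuv.
  by rewrite card_option.
by exists (maxn (max_red_degree H) k), H' => //; exact: ContractionSequenceS cs.
Qed.

(** With [m = M ^ 2 + 1], one has [(2 * m)! >= m ^ m > (M ^ 2) ^ m]. *)
Lemma exists_fact_gt_exp (M : nat) : exists n, (M ^ n.+1 < n.+1`!)%N.
Proof.
have fact_ge j m : (m ^ j <= (m + j)`!)%N.
  elim: j => [|j IH]; first by rewrite fact_gt0.
  by rewrite addnS factS expnS leq_mul // ltnW // ltnS leq_addr.
pose m := (M ^ 2).+1; exists (m + m).-1; rewrite prednK //.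
apply: leq_trans (fact_ge m m); rewrite addnn -mul2n expnM ltn_exp2r //.
Qed.

From mathcomp Require Import all_classical all_reals all_analysis.
From mathcomp Require Import ring lra.
Import Order.TTheory GRing.Theory Num.Theory.
Import numFieldNormedType.Exports.

Local Open Scope ring_scope.
Local Open Scope classical_set_scope.

(** * Charts *)

Section Subspace.
Variables (T : topologicalType) (A : set T).

Lemma val_continuous : continuous (\val : set_type A -> T).
Proof. by rewrite -set_valE; exact: initial_continuous. Qed.

Lemma nbhs_val (x : set_type A) (U : set (set_type A)) :
  nbhs x U -> exists2 W, nbhs (\val x) W & \val @^-1` W `<=` U.
Proof.
case=> _ [[W oW <-] Wx] sub; rewrite set_valE in Wx sub.
by exists W => //; exact: open_nbhs_nbhs.
Qed.

Lemma continuous_set_type (S : topologicalType) (f : S -> set_type A) :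
  continuous (fun x => \val (f x)) -> continuous f.
Proof. move=> cf x U /nbhs_val[W nW sub]; change (nbhs x (f @^-1` U)).
have nx : nbhs x (fun y => W (\val (f y))) := cf x W nW.
by apply: filterS nx => y; exact: sub. Qed.

Lemma compact_set_type : compact A -> compact [set: set_type A].
Proof.
move=> cA F FF _; have FA : F (\val @^-1` A).
  refine (@filterS _ F _ setT _ _ _); last exact: filterT.
  by move=> x _; exact: (set_valP x).
have [p [Ap clp]] := cA (\val @ F) _ FA.
exists (exist _ p (mem_set Ap)); split=> // B D FB /nbhs_val[W nW sub].
have [|x [[b Bb <-] Wb]] := clp (\val @` B) W _ nW; last by exists b; split=> //; apply: sub.
by refine (@filterS _ F _ B _ _ FB) => b Bb; exists b.
Qed.

Lemma hausdorff_set_type : hausdorff_space T -> hausdorff_space (set_type A).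
Proof.
move=> hT p q clpq; apply: val_inj; apply: hT => B D nB nD.
have [| | x [Bx Dx]] := clpq (\val @^-1` B) (\val @^-1` D).
- exact: val_continuous.
- exact: val_continuous.
by exists (\val x).
Qed.

End Subspace.

Lemma second_countable_set_type (R : realType) (T : pseudoMetricType R) (A : set T) :
  compact A -> @second_countable (set_type A).
Proof.
move=> /compact_set_type cA.
have [[p _]|A0] := pselect (exists p : set_type A, True).
  pose P : pseudoPMetricType R := HB.pack (set_type A) (isPointed.Build (set_type A) p).
  exact: (@compact_second_countable R P).
exists set0 => //; split => // x.
by case: A0; exists x.
Qed.

(* A chart is given by an open set [W] of the ambient space, a map [f] and its inverse [g]. *)
Definition locally_euclidean (R : realType) (n d : nat) (A : set 'rV[R]_n) : Prop :=
  forall x, A x -> exists W (f : 'rV[R]_n -> 'rV[R]_d) (g : 'rV[R]_d -> 'rV[R]_n),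
    [/\ open W /\ W x, forall y, W y -> {for y, continuous f}, continuous g,
        forall y, [/\ W (g y), A (g y) & f (g y) = y] &
        forall z, W z -> A z -> g (f z) = z].

Lemma compact_manifold_set_type (R : realType) (n d : nat) (A : set 'rV[R]_n) :
  compact A -> locally_euclidean d A -> compact_manifold R d (set_type A).
Proof.
move=> cA le; split; last exact: compact_set_type.
split; first exact: second_countable_set_type cA.
  by apply: hausdorff_set_type; exact: norm_hausdorff.
move=> x; have [W [f [g [[oW Wx] cf cg gP fK]]]] := le (\val x) (set_valP x).
pose U := \val @^-1` W : set (set_type A).
exists U; split=> //; first by exists W => //; rewrite set_valE.
left.
have Ag y : A (g y) by have [] := gP y.
pose g1 y : set_type A := exist _ (g y) (mem_set (Ag y)).
have Ug y : U (g1 y) by have [] := gP y.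
pose g2 y : set_type U := exist _ (g1 y) (mem_set (Ug y)).
exists (fun y => f (\val (\val y))), g2; split.
- move=> y; apply: (@continuous_comp _ _ _ (fun y : set_type U => \val (\val y)) f).
    by apply: continuous_comp; exact: val_continuous.
  by apply: cf; exact: (set_valP y).
- by apply: continuous_set_type; apply: continuous_set_type.
- move=> y; apply: val_inj; apply: val_inj => /=; apply: fK; last exact: set_valP.
  exact: (set_valP y).
- by move=> y /=; have [] := gP y.
Qed.

Section RealContinuity.
Variables (R : realType) (X : topologicalType) (p : X).
Implicit Types h k : X -> R.

Lemma cts_add h k : {for p, continuous h} -> {for p, continuous k} ->
  {for p, continuous (fun x => h x + k x)}.
Proof. by move=> ch ck; apply: cvgD. Qed.

Lemma cts_opp h : {for p, continuous h} -> {for p, continuous (fun x => - h x)}.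
Proof. by move=> ch; apply: cvgN. Qed.

Lemma cts_mul h k : {for p, continuous h} -> {for p, continuous k} ->
  {for p, continuous (fun x => h x * k x)}.
Proof. by move=> ch ck; apply: cvgM. Qed.

Lemma cts_div h k : k p != 0 -> {for p, continuous h} -> {for p, continuous k} ->
  {for p, continuous (fun x => h x / k x)}.
Proof. by move=> k0 ch ck; apply: cts_mul => //; exact: (continuousV k0). Qed.

Lemma cts_max h k : {for p, continuous h} -> {for p, continuous k} ->
  {for p, continuous (fun x => Num.max (h x) (k x))}.
Proof. by move=> ch ck; exact: continuous_max. Qed.

Lemma cts_min h k : {for p, continuous h} -> {for p, continuous k} ->
  {for p, continuous (fun x => Num.min (h x) (k x))}.
Proof. by move=> ch ck; exact: continuous_min. Qed.

Lemma cts_sum (I : Type) (r : seq I) (P : pred I) (h : I -> X -> R) :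
  (forall i, P i -> {for p, continuous (h i)}) ->
  {for p, continuous (fun x => \sum_(i <- r | P i) h i x)}.
Proof.
move=> ch; elim: r => [|i r IH].
  rewrite (_ : (fun x => _) = fun _ => 0); first exact: cst_continuous.
  by apply/funext => x; rewrite big_nil.
rewrite (_ : (fun x => _) = fun x => if P i then h i x + \sum_(i <- r | P i) h i x
  else \sum_(i <- r | P i) h i x); last by apply/funext => x; rewrite big_cons.
by case Pi : (P i) => //; apply: cts_add => //; exact: ch.
Qed.

Lemma cts_rV (n : nat) (f : X -> 'rV[R]_n) :
  (forall j, {for p, continuous (fun x => f x ord0 j)}) -> {for p, continuous f}.
Proof.
move=> cf U [P nP sub]; change (nbhs p (f @^-1` U)).
have near_p : nbhs p (fun x => forall j, P ord0 j (f x ord0 j)).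
  by apply: filter_forall => j; exact: (cf j _ (nP ord0 j)).
by apply: filterS near_p => x Px; apply: sub => i j; rewrite ord1.
Qed.

Lemma cts_coord (n : nat) (f : X -> 'rV[R]_n) (j : 'I_n) :
  {for p, continuous f} -> {for p, continuous (fun x => f x ord0 j)}.
Proof.
move=> cf; apply: (@continuous_comp _ _ _ f (fun M : 'rV[R]_n => M ord0 j)) => //.
exact: coord_continuous.
Qed.

End RealContinuity.

(* The cone over the [m]-cycle with vertices [0, ..., m - 1]. *)
Definition cycle_cone (R : realType) (m : nat) (t : nat -> R) : Prop :=
  (forall i, (i < m)%N -> 0 <= t i) /\
  exists2 i, (i < m)%N & forall j, (j < m)%N -> t j != 0 -> (j == i) || (j == i.+1 %% m)%N.

(** The cone is homeomorphic to the plane. Continuity is stated after composition with maps from an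
    arbitrary space, which avoids a topology on [nat -> R]. *)
Definition cycle_cone_plane (R : realType) (m : nat) : Prop :=
  exists (f1 f2 : (nat -> R) -> R) (g : R -> R -> nat -> R),
  [/\ forall t t', (forall i, (i < m)%N -> t i = t' i) -> f1 t = f1 t' /\ f2 t = f2 t',
      forall (X : topologicalType) (p : X) (h : nat -> X -> R),
        (forall i, (i < m)%N -> {for p, continuous (h i)}) ->
        {for p, continuous (fun x => f1 (h ^~ x))} /\ {for p, continuous (fun x => f2 (h ^~ x))},
      forall (X : topologicalType) (p : X) (a b : X -> R) i, (i < m)%N ->
        {for p, continuous a} -> {for p, continuous b} ->
        {for p, continuous (fun x => g (a x) (b x) i)},
      forall a b, [/\ cycle_cone m (g a b), f1 (g a b) = a & f2 (g a b) = b] &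
      forall t, cycle_cone m t -> forall i, (i < m)%N -> g (f1 t) (f2 t) i = t i].

(** The sectors are the four quadrants: opposite rays carry the positive and the negative part of
    one coordinate. *)
Lemma cycle_cone4 (R : realType) : cycle_cone_plane R 4.
Proof.
pose pos (a : R) := Num.max a 0.
exists (fun t => t 0%N - t 2%N), (fun t => t 1%N - t 3%N),
  (fun a b i => match i with 0 => pos a | 1 => pos b | 2 => pos (- a) | _ => pos (- b) end).
split.
- by move=> t t' E; rewrite !E.
- by move=> X p h ch; split; apply: cts_add; try apply: cts_opp; apply: ch.
- move=> X p a b i i4 ca cb.
  have c0 : {for p, continuous (fun=> 0 : R)} by exact: cst_continuous.
  case: i i4 => [|[|[|[|//]]]] _; apply: cts_max => //; exact: cts_opp.
- move=> a b; rewrite /pos; split; [split| |]; try (by rewrite !maxElt; do 2 case: ltP => ?; lra).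
    by move=> [|[|[|[|//]]]] _; rewrite le_max lexx orbT.
  have p0 (x : R) : x <= 0 -> Num.max x 0 = 0 by move=> x0; rewrite max_r.
  have [a0|a0] := leP 0 a; have [b0|b0] := leP 0 b.
  + by exists 0%N => // -[|[|[|[|//]]]] //= _; rewrite ?p0 ?eqxx //; lra.
  + by exists 3%N => // -[|[|[|[|//]]]] //= _; rewrite ?p0 ?eqxx //; lra.
  + by exists 1%N => // -[|[|[|[|//]]]] //= _; rewrite ?p0 ?eqxx //; lra.
  + by exists 2%N => // -[|[|[|[|//]]]] //= _; rewrite ?p0 ?eqxx //; lra.
move=> t [t0 [i i4 supp]] j j4.
have z j' : (j' < 4)%N -> (j' != i) && (j' != i.+1 %% 4)%N -> t j' = 0.
  by move=> lt; rewrite -negb_or => ns; apply/eqP; apply: contraR ns; exact: supp.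
have := t0 0%N isT; have := t0 1%N isT; have := t0 2%N isT; have := t0 3%N isT.
rewrite /pos !maxElt; case: i i4 z supp => [|[|[|[|//]]]] _ z _.
- have := z 2%N isT isT; have := z 3%N isT isT; case: j j4 => [|[|[|[|//]]]] _; case: ltP => ?; lra.
- have := z 0%N isT isT; have := z 3%N isT isT; case: j j4 => [|[|[|[|//]]]] _; case: ltP => ?; lra.
- have := z 0%N isT isT; have := z 1%N isT isT; case: j j4 => [|[|[|[|//]]]] _; case: ltP => ?; lra.
- have := z 1%N isT isT; have := z 2%N isT isT; case: j j4 => [|[|[|[|//]]]] _; case: ltP => ?; lra.
Qed.

(* The ray [m] of the cone over the (m + 1)-cycle is mapped to the sum of its neighbours
   [m - 1] and [0], which subdivides the last sector of the cone over the [m]-cycle. *)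
Lemma cycle_coneS (R : realType) (m : nat) :
  (3 <= m)%N -> cycle_cone_plane R m -> cycle_cone_plane R m.+1.
Proof.
move=> m3 [f1 [f2 [g [ext cf cg gP fK]]]].
pose merge (t : nat -> R) i :=
  if i == 0%N then t i + t m else if i == m.-1 then t i + t m else t i.
(* The inverse of [merge]: the new ray takes the smaller weight of its two neighbours. This is 0
   outside the last sector, since for [m >= 3] no other sector contains both. *)
pose split (u : nat -> R) i :=
  let tau := Num.min (u 0%N) (u m.-1) in
  if i == m then tau else if (i == 0%N) || (i == m.-1) then u i - tau else u i.
have m0 : (0 < m)%N by lia.
have m1 : (m.-1 < m)%N by lia.
have lt_neq i : (i < m)%N -> (i == m) = false by lia.
have m1_0 : (m.-1 == 0)%N = false by lia.
have merge_split u i : (i < m)%N -> merge (split u) i = u i.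
  move=> im; rewrite /merge /split eqxx (lt_neq _ im).
  by case: (i == 0%N) => /=; [|case: (i == m.-1)]; rewrite ?subrK.
have cone_split u : cycle_cone m u -> cycle_cone m.+1 (split u).
  case=> u0 [i im supp]; split.
    move=> j jm; rewrite /split; case: (eqVneq j m) => [_|jm'].
      by rewrite le_min !u0.
    case: ifP => [/orP[]/eqP->|_]; rewrite ?subr_ge0 ?ge_min ?lexx ?orbT //.
    by apply: u0; lia.
  have [iE|iE] := eqVneq i m.-1.
    have supp' j : (j < m)%N -> j != 0%N -> j != m.-1 -> u j = 0.
      move=> jm j0 j1; apply/eqP; apply: contraT => /(supp j jm).
      by rewrite iE (negPf j1) prednK // modnn (negPf j0).
    have [le|lt] := leP (u 0%N) (u m.-1).
      exists m.-1; first by lia.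
      move=> j jm; rewrite prednK // modn_small // /split (min_l le).
      case: (eqVneq j m) => [_|jm']; first by rewrite orbT.
      case: (eqVneq j 0%N) => [->|j0] /=; first by rewrite subrr eqxx.
      by case: (eqVneq j m.-1) => //= j1; rewrite supp' ?eqxx //; lia.
    exists m => // j jm; rewrite modnn /split (min_r (ltW lt)).
    case: (eqVneq j m) => [//|jm'].
    case: (eqVneq j 0%N) => [->//|j0] /=.
    case: (eqVneq j m.-1) => [->|j1] /=; first by rewrite subrr eqxx.
    by rewrite supp' ?eqxx //; lia.
  exists i; first by lia.
  have tau0 : Num.min (u 0%N) (u m.-1) = 0.
    have [i0|i0] := eqVneq i 0%N.
      have -> : u m.-1 = 0.
        by apply/eqP; apply: contraT => /(supp _ m1); rewrite i0 modn_small; lia.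
      by rewrite min_r // u0.
    have -> : u 0%N = 0.
      by apply/eqP; apply: contraT => /(supp _ m0); rewrite modn_small; lia.
    by rewrite min_l // u0.
  move=> j jm; rewrite /split tau0 subr0 if_same.
  case: (eqVneq j m) => [_|jm']; first by rewrite eqxx.
  have jm2 : (j < m)%N by lia.
  by move/(supp j jm2); rewrite !modn_small; lia.
have cone_merge t : cycle_cone m.+1 t ->
    cycle_cone m (merge t) /\ forall i, (i < m.+1)%N -> split (merge t) i = t i.
  case=> t0 [i im supp].
  have z j : (j < m.+1)%N -> (j != i) -> (j != i.+1 %% m.+1)%N -> t j = 0.
    by move=> jm h1 h2; apply/eqP; apply: contraT => /(supp j jm); rewrite (negPf h1) (negPf h2).
  have tm := t0 m (ltnSn m).
  have mt0 : merge t 0%N = t 0%N + t m by [].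
  have mtm : merge t m.-1 = t m.-1 + t m by rewrite /merge m1_0 eqxx.
  have mtj j : j != 0%N -> j != m.-1 -> merge t j = t j.
    by move=> j0 j1; rewrite /merge (negPf j0) (negPf j1).
  split.
    split.
      move=> j jm; rewrite /merge; do 2?case: ifP => _; rewrite ?addr_ge0 ?t0 //; lia.
    have [i1|i1] := leqP i.+1 m.-1.
      have tm0 : t m = 0 by apply: z; rewrite ?modn_small; lia.
      exists i; first by lia.
      move=> j jm; rewrite /merge tm0 addr0 !if_same => tj.
      have := supp j (ltnW jm) tj; rewrite !modn_small //; lia.
    exists m.-1 => // j jm; rewrite prednK // modnn.
    case: (eqVneq j 0%N) => [_|j0]; first by rewrite orbT.
    case: (eqVneq j m.-1) => [//|j1]; rewrite mtj // z ?eqxx //; first by lia.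
      by lia.
    have [->|->] : i = m \/ i = m.-1 by lia.
      by rewrite modnn.
    by rewrite prednK // modn_small //; lia.
  have tauE : Num.min (merge t 0%N) (merge t m.-1) = t m.
    rewrite mt0 mtm; have [i1|i1] := leqP i.+1 m.-1.
      have tm0 : t m = 0 by apply: z; rewrite ?modn_small; lia.
      rewrite tm0 !addr0; have [i0|i0] := eqVneq i 0%N.
        have -> : t m.-1 = 0 by apply: z; rewrite ?modn_small; lia.
        by rewrite min_r // t0.
      have -> : t 0%N = 0 by apply: z; rewrite ?modn_small; lia.
      by rewrite min_l // t0 //; lia.
    have [iE|iE] : i = m \/ i = m.-1 by lia.
      have -> : t m.-1 = 0 by apply: z; rewrite ?iE ?modnn; lia.
      by rewrite add0r min_r // lerDr t0.
    have -> : t 0%N = 0 by apply: z; rewrite ?iE ?prednK ?modn_small; lia.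
    by rewrite add0r min_l // lerDr t0 //; lia.
  move=> j jm; rewrite /split tauE; case: (eqVneq j m) => [->//|jm'].
  case: (eqVneq j 0%N) => [->|j0] /=; first by rewrite mt0 addrK.
  by case: (eqVneq j m.-1) => [->|j1] /=; rewrite ?mtm ?addrK // mtj.
exists (fun t => f1 (merge t)), (fun t => f2 (merge t)), (fun a b => split (g a b)); split.
- move=> t t' E; apply: ext => i im.
  by rewrite /merge !E //; lia.
- move=> X p h ch; apply: (cf X p (fun i x => merge (h ^~ x) i)) => i im; rewrite /merge.
  case: (i == 0%N); first by apply: cts_add; apply: ch; lia.
  case: (i == m.-1); first by apply: cts_add; apply: ch; lia.
  by apply: ch; lia.
- move=> X p a b i im ca cb; rewrite /split.
  have cmin : {for p, continuous (fun x => Num.min (g (a x) (b x) 0%N) (g (a x) (b x) m.-1))}.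
    by apply: cts_min; apply: cg.
  case: (eqVneq i m) => [//|im'].
  have ci : {for p, continuous (fun x => g (a x) (b x) i)} by apply: cg => //; lia.
  by case: (_ || _) => //; apply: cts_add => //; apply: cts_opp.
- move=> a b; have [gc g1 g2] := gP a b.
  have [e1 e2] := ext (merge (split (g a b))) (g a b) (merge_split (g a b)).
  by split; [exact: cone_split|rewrite e1|rewrite e2].
- move=> t /cone_merge[mc sm] i im; rewrite -[RHS]sm // /split.
  rewrite (fK _ mc _ m0) (fK _ mc _ m1); case: (eqVneq i m) => // im'.
  by rewrite (fK _ mc i) //; lia.
Qed.

Lemma cycle_coneP (R : realType) (m : nat) : (4 <= m)%N -> cycle_cone_plane R m.
Proof.
elim: m => // m IH; rewrite leq_eqVlt => /orP[/eqP<-|lt]; first exact: cycle_cone4.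
by apply: cycle_coneS; [lia|exact: IH].
Qed.

(** * Geometric realizations *)

Section Weights.
Variables (R : realType) (V : finType).
Implicit Types x y : 'rV[R]_#|V|.

Definition weight x (v : V) : R := x ord0 (enum_rank v).

Definition point_of_weights (h : V -> R) : 'rV[R]_#|V| := \row_k h (enum_val k).

Lemma weight_point h v : weight (point_of_weights h) v = h v.
Proof. by rewrite /weight mxE enum_rankK. Qed.

Lemma eq_weight x y : (forall v, weight x v = weight y v) -> x = y.
Proof. by move=> E; apply/rowP => k; have := E (enum_val k); rewrite /weight enum_valK. Qed.

Lemma weight_sum x : \sum_i x ord0 i = \sum_v weight x v.
Proof.
rewrite (reindex (@enum_rank V)) //.
by exists (@enum_val V predT) => ? _; rewrite ?enum_rankK ?enum_valK.
Qed.

Lemma cts_point (X : topologicalType) (p : X) (h : X -> V -> R) :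
  (forall v, {for p, continuous (fun a => h a v)}) ->
  {for p, continuous (fun a => point_of_weights (h a))}.
Proof.
move=> ch; apply: cts_rV => j; rewrite (_ : (fun a => _) = fun a => h a (enum_val j)) //.
by apply/funext => x; rewrite mxE.
Qed.

Lemma weight_continuous v : continuous (fun x => weight x v).
Proof. exact: coord_continuous. Qed.

End Weights.

Section Realization.
Variables (R : realType) (F V : finType) (d : nat) (c : nat -> F -> V).

Definition on_facet (v : V) (z : F) : Prop := exists2 i, (i <= d)%N & c i z = v.

Definition polyhedron : set 'rV[R]_#|V| := realization R #|V| (balanced_complex d c).

Lemma polyhedronP x : polyhedron x <->
  [/\ forall v, 0 <= weight x v, \sum_v weight x v = 1 &
      exists z, forall v, weight x v != 0 -> on_facet v z].
Proof.
rewrite /polyhedron /realization /= weight_sum; split.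
  case=> x0 x1; rewrite inE => /andP[_ /existsP[z sub]]; split=> // [v|]; first exact: x0.
  exists z => v xv; have : enum_rank v \in facet_set d c z.
    by apply: (fintype.subsetP sub); rewrite inE.
  by case/imsetP=> i _ /enum_rank_inj ->; exists i => //; rewrite -ltnS.
case=> x0 x1 [z supp]; split=> // [i|].
  by have := x0 (enum_val i); rewrite /weight enum_valK.
rewrite inE; apply/andP; split.
  apply: contraTneq isT => E; have : (1 : R) = 0 :> R.
    rewrite -x1 big1 // => v _; apply/eqP; apply: contraT => xv.
    by have := finset.in_set0 (enum_rank v); rewrite -E inE /= -/(weight x v) xv.
  by move/eqP; rewrite oner_eq0.
apply/existsP; exists z; apply/fintype.subsetP => k; rewrite inE => xk.
have [|i id ci] := supp (enum_val k); first by rewrite /weight enum_valK.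
apply/imsetP; exists (Ordinal (id : (i < d.+1)%N)) => //=.
by rewrite ci enum_valK.
Qed.

Lemma closed_polyhedron : closed polyhedron.
Proof.
pose face z := [set x : 'rV[R]_#|V| | forall v, ~ on_facet v z -> weight x v = 0].
have -> : polyhedron = (\bigcap_(v in [set: V]) [set x | 0 <= weight x v]) `&`
    [set x | \sum_v weight x v = 1] `&` \bigcup_(z in [set: F]) face z.
  apply/seteqP; split => x.
    case/polyhedronP=> x0 x1 [z supp]; split; last first.
      exists z => // v nv; apply/eqP; apply: contraT => /supp //.
    by split=> // v _; exact: x0.
  case=> [[x0 x1] [z _ supp]]; apply/polyhedronP; split=> // [v|]; first exact: x0.
  by exists z => v xv; apply: contrapT => /supp E; rewrite E eqxx in xv.
apply: closedI; first apply: closedI.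
- apply: closed_bigI => v _.
  by apply: (preimage_closed _ (@closed_ge R 0)) => x _; exact: weight_continuous.
- apply: (preimage_closed _ (@closed_eq R 1)) => x _.
  by apply: cts_sum => v _; exact: weight_continuous.
- apply: closed_bigcup; first exact: finite_finset.
  move=> z _; rewrite /face.
  have -> : [set x : 'rV[R]_#|V| | forall v, ~ on_facet v z -> weight x v = 0] =
      \bigcap_(v in [set v | ~ on_facet v z]) [set x | weight x v = 0] by [].
  apply: closed_bigI => v _.
  by apply: (preimage_closed _ (@closed_eq R 0)) => x _; exact: weight_continuous.
Qed.

Lemma compact_polyhedron : compact polyhedron.
Proof.
apply: (subclosed_compact closed_polyhedron (@rV_compact R _ (fun _ => `[0, 1]%classic) _)).
  by move=> i; exact: segment_compact.
move=> x /polyhedronP[x0 x1 _] i /=; have := x0 (enum_val i).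
rewrite in_itv /= -x1 (bigD1 (enum_val i)) //= /weight enum_valK => -> /=.
by rewrite lerDl sumr_ge0 // => v _; exact: x0.
Qed.

End Realization.

(** The chart is the open star of a vertex [v] of positive weight: dividing by the weight of [v]
    identifies the star with the cone over the link, hence with the plane. *)
Lemma locally_euclidean_links (R : realType) (F V : finType) (d : nat) (c : nat -> F -> V) :
  (forall i z, (i <= d)%N -> exists u, has_cyclic_link d c (c i z) u) ->
  locally_euclidean 2 (polyhedron (R := R) d c).
Proof.
move=> links x /polyhedronP[x0 x1 [z0 supp0]].
have [v xv] : exists v, weight x v != 0.
  apply: contrapT => nv; have : (1 : R) != 0 by rewrite oner_eq0.
  rewrite -x1 big1 ?eqxx // => v _; apply/eqP; apply: contraT => xv.
  by case: nv; exists v.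
have [i id iv] := supp0 v xv.
have [u] := links i z0 id; rewrite iv => -[u4 /= /andP[vu uu] sub sup].
pose m := size u; pose e j := nth v u j.
have eu j : (j < m)%N -> e j \in u by move=> jm; rewrite mem_nth.
have ev j : (j < m)%N -> (e j == v) = false.
  by move=> jm; apply: contraNF vu => /eqP <-; exact: eu.
have idx j : (j < m)%N -> index (e j) u = j by move=> jm; rewrite index_uniq.
have [f1 [f2 [g [ext cf cg gP fK]]]] := cycle_coneP R u4.
pose coef (y : 'rV[R]_#|V|) j := weight y (e j) / weight y v.
pose f y : 'rV[R]_2 := \row_j (if j == ord0 then f1 (coef y) else f2 (coef y)).
pose q1 : 'I_2 := lift ord0 ord0.
pose t (q : 'rV[R]_2) := g (q ord0 ord0) (q ord0 q1).
(* The total weight when that of [v] is set to 1; dividing by it returns to the simplex. *)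
pose S q := 1 + \sum_(j < m) t q j.
pose h q w := (if w == v then 1 else if w \in u then t q (index w u) else 0) / S q.
have t0 q j : (j < m)%N -> 0 <= t q j by have [[+ _] _ _] := gP (q ord0 ord0) (q ord0 q1); apply.
have S0 q : 0 < S q by rewrite ltr_pwDl // sumr_ge0 // => j _; exact: t0.
have hv q : h q v = 1 / S q by rewrite /h eqxx.
have he q j : (j < m)%N -> h q (e j) = t q j / S q by move=> jm; rewrite /h ev // eu // idx.
have star_sum (k : V -> R) : (forall w, k w != 0 -> w = v \/ w \in u) ->
    \sum_w k w = k v + \sum_(j < m) k (e j).
  move=> sk; rewrite (bigID (mem (v :: u))) /= addrC big1 ?add0r; last first.
    move=> w; rewrite inE negb_or => /andP[wv wu]; apply/eqP; apply: contraT => /sk[E|E].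
      by rewrite E eqxx in wv.
    by rewrite E in wu.
  rewrite -big_uniq /=; last by rewrite vu.
  by rewrite big_cons (big_nth v) big_mkord.
exists [set y | 0 < weight y v], f, (fun q => point_of_weights (h q)); split.
- split; last by rewrite /= lt_def xv x0.
  apply: (@open_comp _ _ (fun y : 'rV[R]_#|V| => weight y v) [set r | 0 < r]); last exact: open_gt.
  by move=> y _; exact: weight_continuous.
- move=> y /= yv; have cc j : {for y, continuous (fun y => coef y j)}.
    by apply: cts_div; [rewrite gt_eqF|exact: weight_continuous|exact: weight_continuous].
  have [c1 c2] := cf _ y (fun j y => coef y j) (fun j _ => cc j).
  apply: cts_rV => j; case: (eqVneq j ord0) => [->|j0].
    by rewrite (_ : (fun y => _) = fun y => f1 (coef y)) //; apply/funext => a; rewrite mxE.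
  rewrite (_ : (fun y => _) = fun y => f2 (coef y)) //; apply/funext => a.
  by rewrite mxE (negPf j0).
- move=> q; apply: cts_point => w.
  have ct j : (j < m)%N -> {for q, continuous (fun q => t q j)}.
    by move=> jm; apply: cg => //; exact: coord_continuous.
  apply: cts_div; first by rewrite gt_eqF.
    case: (w == v); first exact: cst_continuous.
    by case wu: (w \in u); [apply: ct; rewrite index_mem|exact: cst_continuous].
  by apply: cts_add; [exact: cst_continuous|apply: cts_sum => j _; exact: ct].
- move=> q; have [[_ [i0 i0m supp]] f1K f2K] := gP (q ord0 ord0) (q ord0 q1).
  split; first by rewrite /= weight_point hv divr_gt0.
    apply/polyhedronP; split.
    + move=> w; rewrite weight_point /h; apply: divr_ge0; last exact: ltW.
      by case: ifP => // _; case: ifP => // wu; apply: t0; rewrite index_mem.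
    + have -> : \sum_w weight (point_of_weights (h q)) w = \sum_w h q w.
        by apply: eq_bigr => w _; rewrite weight_point.
      rewrite star_sum; last first.
        move=> w; rewrite /h; case: (eqVneq w v) => [->|_]; first by left.
        by case: ifP => [|_]; [right|rewrite mul0r eqxx].
      rewrite hv (eq_bigr (fun j : 'I_m => t q j / S q)); last by move=> j _; rewrite he.
      by rewrite -mulr_suml -mulrDl -/(S q) divff // gt_eqF.
    + have [z [vz z1 z2]] := sup i0 i0m; exists z => w; rewrite weight_point /h.
      case: (eqVneq w v) => [->//|_]; case: ifP => [wu|_]; last by rewrite mul0r eqxx.
      rewrite mulf_eq0 negb_or => /andP[tw _].
      have := supp (index w u); rewrite index_mem => /(_ wu tw).
      by case/orP=> /eqP E; rewrite -(nth_index v wu) E.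
  have cq j : (j < m)%N -> coef (point_of_weights (h q)) j = t q j.
    move=> jm; rewrite /coef !weight_point hv he // div1r invrK mulfVK //.
    by rewrite gt_eqF.
  have [e1 e2] := ext _ _ cq.
  apply/rowP => j; rewrite mxE e1 e2; case: (eqVneq j ord0) => [->//|j0].
  have -> : j = q1 by apply: val_inj; case: j j0 => [[|[|//]] ?].
  exact: f2K.
move=> y /= yv /polyhedronP[y0 y1 [z supp]].
have yv0 : weight y v != 0 by rewrite gt_eqF.
have [i1 i1m zsub] := sub z (supp v yv0).
have ysub w : weight y w != 0 -> w \in [:: v; e i1; e (i1.+1 %% m)%N].
  by case/supp=> j jd <-; exact: zsub.
have cone : cycle_cone m (coef y).
  split; first by move=> j jm; rewrite /coef divr_ge0.
  exists i1 => // j jm; rewrite /coef mulf_eq0 negb_or => /andP[/ysub + _].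
  have mm : ((i1.+1 %% m)%N < m)%N by rewrite ltn_mod; lia.
  rewrite !inE ev //= => /orP[]/eqP/(congr1 (index^~ u)); rewrite !idx // => ->;
  by rewrite eqxx ?orbT.
have tE j : (j < m)%N -> t (f y) j = coef y j.
  by move=> jm; rewrite /t /f !mxE; exact: fK.
have ystar w : weight y w != 0 -> w = v \/ w \in u.
  have mm : ((i1.+1 %% m)%N < m)%N by rewrite ltn_mod; lia.
  by move/ysub; rewrite !inE => /or3P[]/eqP->; [left|right; exact: eu|right; exact: eu].
have SE : S (f y) = (weight y v)^-1.
  rewrite /S (eq_bigr (fun j : 'I_m => coef y j)); last by move=> j _; rewrite tE.
  by rewrite -mulr_suml; apply: (mulIf yv0); rewrite mulrDl mul1r mulfVK // mulVf // -star_sum.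
apply: eq_weight => w; rewrite weight_point /h SE invrK.
case: (eqVneq w v) => [->|wv]; first by rewrite mul1r.
case: ifP => wu; last first.
  rewrite mul0r; apply/esym/eqP; apply: contraT => /ystar[E|E]; first by rewrite E eqxx in wv.
  by rewrite E in wu.
by rewrite tE ?index_mem // /coef /e nth_index // mulfVK.
Qed.

Lemma on_facetP (F V : finType) (d : nat) (rk : V -> nat) (c : nat -> F -> V)
    (t : nat -> F -> F) (bal : balanced d rk c t) v x :
  on_facet d c v x <-> (rk v <= d)%N /\ c (rk v) x = v.
Proof.
split=> [[i id <-]|[rd E]]; last by exists (rk v).
by rewrite (balanced_rk bal).
Qed.

(** * Charts of the 4-cycle *)

Section CircleWeights.
Variable R : realType.
Implicit Types (nu : bool * bool -> R) (r : R).

(** Barycentric coordinates on the 4-cycle: two vertices of the same colour are opposite, hence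
    never both in the support. *)
Definition circle_weights nu : Prop :=
  [/\ forall q, 0 <= nu q,
      nu (false, false) + nu (false, true) + (nu (true, false) + nu (true, true)) = 1 &
      forall b, nu (b, true) = 0 \/ nu (b, false) = 0].

(** The chart on the open star of [q], whose two neighbours have the other colour and give the two
    signs. *)
Definition circle_coord (q : bool * bool) nu : R :=
  (nu (~~ q.1, true) - nu (~~ q.1, false)) / nu q.

Definition circle_point (q : bool * bool) r : bool * bool -> R := fun q' =>
  (if q'.1 == q.1 then if q'.2 == q.2 then 1 else 0
   else if q'.2 then Num.max r 0 else Num.max (- r) 0) / (1 + `|r|).

Lemma circle_pointP q r :
  [/\ circle_weights (circle_point q r), 0 < circle_point q r q &
      circle_coord q (circle_point q r) = r].
Proof.
have n0 : 0 < 1 + `|r| by rewrite ltr_pwDl.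
have n1 : 1 + `|r| != 0 by rewrite gt_eqF.
have qq : circle_point q r q = 1 / (1 + `|r|) by rewrite /circle_point !eqxx.
have nn q' : 0 <= circle_point q r q'.
  rewrite /circle_point; apply: divr_ge0; last exact: ltW.
  by do 3?case: ifP => _; rewrite ?le_max ?lexx ?orbT.
have maxD : Num.max r 0 + Num.max (- r) 0 = `|r|.
  by rewrite !maxElt; case: (ler0P r) => ?; do 2 case: ltP => ?; lra.
have maxB : Num.max r 0 - Num.max (- r) 0 = r by rewrite !maxElt; do 2 case: ltP => ?; lra.
split; last first.
- rewrite /circle_coord qq /circle_point /=; case: q {qq nn} => [[] s] /=;
  by rewrite -mulrBl maxB div1r invrK mulfVK.
- by rewrite qq divr_gt0.
split=> //.
- rewrite /circle_point; case: q {qq nn} => [[] []] /=; rewrite -!mulrDl;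
  by apply: (mulIf n1); rewrite mulfVK // mul1r; have := maxD; lra.
- move=> b; rewrite /circle_point /=; case: (b == q.1).
    by case: q.2; [right|left]; rewrite /= mul0r.
  case/orP: (le_total 0 r) => r0; [right|left]; rewrite max_r ?mul0r //.
  by rewrite oppr_le0.
Qed.

Lemma circle_coordK q nu : circle_weights nu -> 0 < nu q ->
  circle_point q (circle_coord q nu) =1 nu.
Proof.
case=> nu0 nu1 nuz q0; have qn : nu q != 0 by rewrite gt_eqF.
have bs : nu (q.1, ~~ q.2) = 0.
  by case: q q0 qn => [b []] /= q0 qn; case: (nuz b) => // E; rewrite E eqxx in qn.
have n1 : 1 + `|circle_coord q nu| = (nu q)^-1.
  apply: (mulIf qn); rewrite mulVf // mulrDl mul1r /circle_coord normrM normfV.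
  rewrite (gtr0_norm q0) mulfVK // -nu1.
  case: (nuz (~~ q.1)) => E; rewrite E ?sub0r ?subr0 ?normrN (ger0_norm (nu0 _)); move: bs E;
  by case: q {q0 qn} => [[] []] /= -> ->; ring.
move=> [b s]; rewrite /circle_point n1 invrK /=.
case: (eqVneq b q.1) => [->|bq].
  case: (eqVneq s q.2) => [->|sq]; first by rewrite mul1r; case: (q).
  rewrite mul0r -bs; congr nu; congr pair; by case: s sq; case: q.2.
have {bq} -> : b = ~~ q.1 by case: b bq; case: q.1.
rewrite /circle_coord; have q1 : 0 <= (nu q)^-1 by rewrite invr_ge0.
by case: s; case: (nuz (~~ q.1)) => E; rewrite E ?sub0r ?subr0 ?opprK ?opprB;
  [rewrite max_r ?mul0r // mulNr oppr_le0 mulr_ge0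
  |rewrite max_l ?mulfVK // mulr_ge0
  |rewrite -mulNr opprK max_l ?mulfVK // mulr_ge0
  |rewrite max_r ?mul0r // oppr_le0 mulr_ge0].
Qed.

End CircleWeights.

(** * Monotone couplings *)

Section Coupling.
Variables (R : realType) (F V : finType) (d : nat) (rk : V -> nat).
Variables (c : nat -> F -> V) (t : nat -> F -> F).
Hypothesis bal : balanced d rk c t.

Lemma sum_bool2 (f : bool * bool -> R) :
  \sum_q f q = f (false, false) + f (false, true) + (f (true, false) + f (true, true)).
Proof.
rewrite (eq_bigr (fun q => f (q.1, q.2))); last by case.
by rewrite -(pair_bigA _ (fun b s => f (b, s))) /= !big_bool /=; ring.
Qed.

Lemma min_max_eq (u D w : R) : 0 <= w -> w <= u ->
  [\/ w = D, w = u /\ u <= D | w = 0 /\ D <= 0] -> Num.min u (Num.max 0 D) = w.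
Proof.
move=> w0 wu [wD|[-> uD]|[-> D0]].
- by rewrite -wD max_r // min_r.
- by rewrite max_r ?min_l //; lra.
- by rewrite max_l // min_r //; lra.
Qed.

(** [A] and [B] are the masses over the two ends. Before the step [a] a vertex has all its mass in
    [A], after it none, and at [a] what is left of the total of [A]. The order is abstract because
    [B] needs the reversed one. *)
Lemma clamp_side (lt : rel nat) (A B : V -> R) (a : nat) (v : V) :
  irreflexive lt -> transitive lt -> (forall i j, [\/ lt i j, i = j | lt j i]) ->
  (forall w, 0 <= A w) -> (forall w, 0 <= B w) ->
  (forall w, lt a (rk w) -> A w = 0) -> (forall w, lt (rk w) a -> B w = 0) ->
  (forall w w', A w + B w != 0 -> A w' + B w' != 0 -> rk w = rk w' -> w = w') ->
  Num.min (A v + B v) (Num.max 0 (\sum_w A w - \sum_(w | lt (rk w) (rk v)) (A w + B w))) = A v.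
Proof.
move=> irr tr tri A0 B0 Aa Ba uni.
have zero w : A w + B w = 0 -> A w = 0 by have := A0 w; have := B0 w; lra.
have Dle : lt (rk v) a || (rk v == a) ->
    \sum_w A w - \sum_(w | lt (rk w) (rk v)) (A w + B w) = \sum_(w | ~~ lt (rk w) (rk v)) A w.
  move=> va; rewrite [X in _ - X](eq_bigr A); last first.
    move=> w wv; rewrite Ba ?addr0 //.
    by case/orP: va => [|/eqP <-] //; exact: tr.
  by rewrite (bigID (fun w => lt (rk w) (rk v))) /= addrAC subrr add0r.
apply: min_max_eq => //; first by rewrite lerDl.
case: (tri (rk v) a) => va.
- constructor 2; rewrite Ba // addr0; split=> //; rewrite Dle ?va //.
  by rewrite (bigD1 v) ?irr //= lerDl sumr_ge0.
- have [u0|u0] := eqVneq (A v + B v) 0.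
    constructor 2; rewrite u0 zero //; split=> //.
    by rewrite Dle ?va ?eqxx ?orbT // sumr_ge0.
  constructor 1; rewrite Dle ?va ?eqxx ?orbT // (bigD1 v) ?va ?irr //= big1 ?addr0 //.
  move=> w /andP[nlt wv]; have [//|Aw] := eqVneq (A w) 0.
  case: (tri (rk w) a) => wa; [by rewrite wa in nlt| |by rewrite Aa].
  have uw : A w + B w != 0 by apply: contraNneq Aw => /zero ->.
  by rewrite (uni w v uw u0) ?eqxx ?va // in wv.
- constructor 3; split; first exact: Aa.
  rewrite subr_le0 (bigID (fun w => lt (rk w) (rk v))) /= [X in _ + X]big1 ?addr0; last first.
    move=> w nlt; apply: Aa; case: (tri (rk w) a) => // wa; last by rewrite wa va in nlt.
    by rewrite (tr _ _ _ wa va) in nlt.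
  by apply: ler_sum => w _; rewrite lerDl.
Qed.

Definition marginal1 (z : prod_vertex V -> R) : V -> R := fun v => \sum_q z (v, q).
Definition marginal2 (z : prod_vertex V -> R) : bool * bool -> R := fun q => \sum_v z (v, q).

(* The coupling of [u] and [nu] that is monotone for the colours: its mass at a pair of
   vertices is the length of the overlap of two intervals. *)
Definition coupling (u : V -> R) (nu : bool * bool -> R) : prod_vertex V -> R := fun w =>
  Num.min (u w.1) (Num.max 0
    (nu w.2 - \sum_(v | if w.2.1 then (rk w.1 < rk v)%N else (rk v < rk w.1)%N) u v)).

Definition facet_weights d' (F' V' : finType) (c' : nat -> F' -> V') (u : V' -> R) : Prop :=
  [/\ forall v, 0 <= u v, \sum_v u v = 1 &
      exists z, forall v, u v != 0 -> on_facet d' c' v z].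

Local Notation c' := (prod_c (d := d) c).

(** A facet uses one vertex of each colour of the 4-cycle, so [z] reduces to the masses [A] over
    [y0] and [B] over [y1], which [clamp_side] recovers from the marginals. *)
Lemma prod_facet_weights z : facet_weights d.+1 c' z ->
  [/\ facet_weights d c (marginal1 z), circle_weights (marginal2 z) &
      coupling (marginal1 z) (marginal2 z) =1 z].
Proof.
case=> z0 z1 [[[a x] [y0 y1]] supp].
have supp0 v s : z (v, (false, s)) != 0 -> [/\ s = y0, on_facet d c v x & (rk v <= a)%N].
  case/supp=> i id; rewrite /prod_c; case: leqP => ia [] // vx sy.
  have id' : (i <= d)%N by apply: leq_trans ia _; rewrite -ltnS.
  by split=> //; [exists i|rewrite -vx (balanced_rk bal)].
have supp1 v s : z (v, (true, s)) != 0 -> [/\ s = y1, on_facet d c v x & (a <= rk v)%N].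
  case/supp=> i id; rewrite /prod_c; case: leqP => ia [] // vx sy.
  have id' : (i.-1 <= d)%N by lia.
  by split=> //; [exists i.-1|rewrite -vx (balanced_rk bal) //; lia].
pose A v := z (v, (false, y0)); pose B v := z (v, (true, y1)).
have zf v s : z (v, (false, s)) = if s == y0 then A v else 0.
  by case: eqP => [->//|sy]; apply/eqP; apply: contraT => /supp0[].
have zt v s : z (v, (true, s)) = if s == y1 then B v else 0.
  by case: eqP => [->//|sy]; apply/eqP; apply: contraT => /supp1[].
have m1 v : marginal1 z v = A v + B v.
  by rewrite /marginal1 sum_bool2 !zf !zt; case: (y0) (y1) => -[] /=; ring.
have m2f s : marginal2 z (false, s) = if s == y0 then \sum_v A v else 0.
  rewrite /marginal2 (eq_bigr (fun v => if s == y0 then A v else 0)); last by move=> v _; exact: zf.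
  by case: (s == y0); rewrite ?big1_eq.
have m2t s : marginal2 z (true, s) = if s == y1 then \sum_v B v else 0.
  rewrite /marginal2 (eq_bigr (fun v => if s == y1 then B v else 0)); last by move=> v _; exact: zt.
  by case: (s == y1); rewrite ?big1_eq.
have A0 v : 0 <= A v by exact: z0.
have B0 v : 0 <= B v by exact: z0.
have AB v : A v + B v != 0 -> on_facet d c v x.
  have [->|/supp0[]//] := eqVneq (A v) 0.
  by rewrite add0r => /supp1[].
have uni w w' : A w + B w != 0 -> A w' + B w' != 0 -> rk w = rk w' -> w = w'.
  by move=> /AB/(on_facetP bal)[_ E] /AB/(on_facetP bal)[_ E'] r; rewrite -E -E' r.
have Aa w : (a < rk w)%N -> A w = 0.
  by move=> lt; apply/eqP; apply: contraT => /supp0[_ _]; rewrite leqNgt lt.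
have Ba w : (rk w < a)%N -> B w = 0.
  by move=> lt; apply/eqP; apply: contraT => /supp1[_ _]; rewrite leqNgt lt.
have sumz : \sum_v \sum_q z (v, q) = 1.
  by rewrite pair_bigA /= -z1; apply: eq_bigr => -[v q] _.
have tri i j : [\/ (i < j)%N, i = j | (j < i)%N].
  by case: (ltngtP i j); [constructor 1|constructor 3|constructor 2].
split.
- split=> // [v|]; first by rewrite m1 addr_ge0.
  by exists x => v; rewrite m1; exact: AB.
- split.
  + by move=> q; apply: sumr_ge0 => v _; exact: z0.
  + by rewrite -sum_bool2 /marginal2 exchange_big.
  + by move=> [|]; [rewrite !m2t; case: (y1)|rewrite !m2f; case: (y0)]; by [left|right].
- have nonneg v : 0 <= marginal1 z v by rewrite m1 addr_ge0.
  have zero v D : D <= 0 -> Num.min (marginal1 z v) (Num.max 0 D) = 0.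
    by move=> D0; apply: min_max_eq => //; constructor 3.
  case=> v [[] s]; rewrite /coupling /= ?zt ?zf ?m2t ?m2f; case: eqVneq => [_|_].
  + rewrite m1 [B v in RHS](_ : _ = Num.min (B v + A v) (Num.max 0 (\sum_w B w -
      \sum_(w | (rk v < rk w)%N) (B w + A w)))).
      by rewrite [A v + _]addrC; congr (Num.min _ (Num.max _ (_ - _)));
        apply: eq_bigr => w _; rewrite m1 addrC.
    apply/esym/(@clamp_side (fun i j => (j < i)%N) B A a v) => //.
    * by move=> i; rewrite /= ltnn.
    * by move=> i j k /= h1 h2; exact: ltn_trans h2 h1.
    * by move=> i j; case: (tri j i) => h; [constructor 1|constructor 2|constructor 3].
    * by move=> w w'; rewrite ![B _ + _]addrC; exact: uni.
  + by apply: zero; rewrite sub0r oppr_le0 sumr_ge0.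
  + rewrite m1 [A v in RHS](_ : _ = Num.min (A v + B v) (Num.max 0 (\sum_w A w -
      \sum_(w | (rk w < rk v)%N) (A w + B w)))).
      by congr (Num.min _ (Num.max _ (_ - _))); apply: eq_bigr => w _; rewrite m1.
    apply/esym/(@clamp_side ltn A B a v) => //; exact: ltn_trans.
  + by apply: zero; rewrite sub0r oppr_le0 sumr_ge0.
Qed.

Lemma exists_coupling u nu : facet_weights d c u -> circle_weights nu ->
  exists z, [/\ facet_weights d.+1 c' z, marginal1 z =1 u & marginal2 z =1 nu].
Proof.
case=> u0 u1 [x supp] [nu0 nu1 nuz].
have nuy b : exists y, nu (b, ~~ y) = 0.
  by case: (nuz b) => E; [exists false|exists true].
have [y0 ny0] := nuy false; have [y1 ny1] := nuy true.
pose tau := nu (false, y0).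
have tau1 : nu (true, y1) = 1 - tau.
  by rewrite /tau -nu1; case: (y0) (y1) ny0 ny1 => -[] /= -> ->; ring.
have P0 i : 0 <= \sum_(v | (rk v < i)%N) u v by exact: sumr_ge0.
have Pd : \sum_(v | (rk v < d.+1)%N) u v = 1.
  rewrite -u1 [RHS](bigID (fun v => (rk v < d.+1)%N)) /= [X in _ = _ + X]big1 ?addr0 // => v nv.
  by apply/eqP; apply: contraNT nv => /supp/(on_facetP bal)[].
have exa : exists a, (tau <= \sum_(v | (rk v < a.+1)%N) u v).
  by exists d; rewrite Pd; have := nu0 (true, y1); rewrite tau1; lra.
(* The step is at the first colour where the cumulative mass of [u] reaches [tau]; the vertex of
   that colour is split and gives [tau - p] to the first end. *)
have [a aP amin] := ex_minnP exa.
have ad : (a <= d)%N.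
  by apply: amin; rewrite Pd; have := nu0 (true, y1); rewrite tau1; lra.
have tau0 : 0 <= tau by exact: nu0.
have aP' : \sum_(v | (rk v < a)%N) u v <= tau.
  case: (a) amin => [|b] amin; first by rewrite big_pred0.
  by apply: ltW; rewrite ltNge; apply/negP => /amin; rewrite ltnn.
set p := \sum_(v | (rk v < a)%N) u v in aP'.
have pS : \sum_(v | (rk v < a.+1)%N) u v = p + u (c a x).
  rewrite (bigID (fun v => (rk v < a)%N)) /=; congr (_ + _).
    by apply: eq_bigl => v; rewrite andb_idl // => /ltnW.
  rewrite (bigD1 (c a x)) /= ?(balanced_rk bal) ?ltnSn ?ltnn //= big1 ?addr0 // => v.
  case/andP=> /andP[v1 v2] vx; apply/eqP; apply: contraNT vx => /supp/(on_facetP bal)[_ <-].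
  by rewrite (_ : rk v = a) //; lia.
pose A v := if (rk v < a)%N then u v else if v == c a x then tau - p else 0.
pose B v := u v - A v.
have A0 v : 0 <= A v.
  by rewrite /A; case: ifP => // _; case: ifP => // _; rewrite subr_ge0.
have Au v : A v <= u v.
  rewrite /A; case: ifP => // _; case: eqVneq => [->|_] //.
  by rewrite lerBlDl -pS.
have B0 v : 0 <= B v by rewrite subr_ge0.
have sA : \sum_v A v = tau.
  rewrite (bigID (fun v => (rk v < a)%N)) /= (eq_bigr u); last by move=> v; rewrite /A => ->.
  rewrite -/p (bigD1 (c a x)) ?(balanced_rk bal) ?ltnn //= big1 ?addr0; last first.
    by move=> v /andP[/negPf nv /negPf vx]; rewrite /A nv vx.
  by rewrite /A (balanced_rk bal) // ltnn eqxx addrC subrK.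
pose z (w : prod_vertex V) : R :=
  if w.2.1 then if w.2.2 == y1 then B w.1 else 0 else if w.2.2 == y0 then A w.1 else 0.
have m1 : marginal1 z =1 u.
  move=> v; rewrite /marginal1 sum_bool2 /z /=.
  by rewrite /B; case: (y0) (y1) => -[] /=; ring.
have m2 : marginal2 z =1 nu.
  case=> [[] s]; rewrite /marginal2 /z /=.
    case: (eqVneq s y1) => [->|sy]; first by rewrite sumrB u1 sA tau1.
    by rewrite big1 // -ny1; congr nu; congr pair; case: (s) (y1) sy => -[].
  case: (eqVneq s y0) => [->|sy]; first by rewrite sA.
  by rewrite big1 // -ny0; congr nu; congr pair; case: (s) (y0) sy => -[].
exists z; split=> //; split.
- by case=> v [[] s]; rewrite /z /=; case: ifP.
- rewrite -[RHS]u1 -[RHS](eq_bigr _ (fun v _ => m1 v)) /marginal1 pair_bigA /=.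
  by apply: eq_bigr => -[v q] _.
exists (inord a, x, (y0, y1)) => -[v [[] s]]; rewrite /z /=.
- case: (eqVneq s y1) => [-> Bv|_]; last by rewrite eqxx.
  have uv : u v != 0.
    by apply: contraNneq Bv => E; rewrite eq_le B0 andbT /B E sub0r oppr_le0.
  have /(on_facetP bal)[vd vx] := supp v uv.
  have av : (a <= rk v)%N by rewrite leqNgt; apply: contraNN Bv => lt; rewrite /B /A lt subrr.
  exists (rk v).+1 => //; rewrite /prod_c inordK ?ltnS //.
  by rewrite leqNgt ltnS av /= vx.
- case: (eqVneq s y0) => [-> Av|_]; last by rewrite eqxx.
  have uv : u v != 0.
    by apply: contraNneq Av => E; rewrite eq_le A0 andbT -E.
  have /(on_facetP bal)[vd vx] := supp v uv.
  have av : (rk v <= a)%N.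
    move: Av; rewrite /A; case: ltnP => [/ltnW //|_].
    by case: (eqVneq v (c a x)) => [->|_]; rewrite ?eqxx // (balanced_rk bal).
  by exists (rk v); rewrite ?(leq_trans vd) // /prod_c inordK ?ltnS // av vx.
Qed.

End Coupling.

Section ProductChart.
Variables (R : realType) (F V : finType) (d : nat) (rk : V -> nat).
Variables (c : nat -> F -> V) (t : nat -> F -> F).
Hypothesis bal : balanced d rk c t.

Local Notation V' := (prod_vertex V).
Local Notation c' := (prod_c (d := d) c).

Lemma cts_marginal1 (X : topologicalType) (p : X) (z : X -> V' -> R) v :
  (forall w, {for p, continuous (fun a => z a w)}) ->
  {for p, continuous (fun a => marginal1 (z a) v)}.
Proof. by move=> cz; apply: cts_sum. Qed.

Lemma cts_marginal2 (X : topologicalType) (p : X) (z : X -> V' -> R) q :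
  (forall w, {for p, continuous (fun a => z a w)}) ->
  {for p, continuous (fun a => marginal2 (z a) q)}.
Proof. by move=> cz; apply: cts_sum. Qed.

Lemma cts_coupling (X : topologicalType) (p : X) (u : X -> V -> R) (nu : X -> bool * bool -> R) w :
  (forall v, {for p, continuous (fun a => u a v)}) ->
  (forall q, {for p, continuous (fun a => nu a q)}) ->
  {for p, continuous (fun a => coupling rk (u a) (nu a) w)}.
Proof.
move=> cu cnu; apply: cts_min => //; apply: cts_max; first exact: cst_continuous.
by apply: cts_add => //; apply: cts_opp; apply: cts_sum.
Qed.

Lemma cts_circle_point (X : topologicalType) (p : X) (r : X -> R) q q' :
  {for p, continuous r} -> {for p, continuous (fun a => circle_point q (r a) q')}.
Proof.
move=> cr; have c0 (k : R) : {for p, continuous (fun _ : X => k)} by exact: cst_continuous.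
apply: cts_div; first by rewrite gt_eqF // ltr_pwDl.
  case: (q'.1 == q.1); first by case: (q'.2 == q.2); exact: c0.
  by case: (q'.2); apply: cts_max; rewrite ?c0 //; exact: cts_opp.
by apply: cts_add; [exact: c0|exact: cvg_norm].
Qed.

(** Marginals and coupling are mutually inverse and continuous, so a chart of the factor and the
    chart of the 4-cycle at a vertex [q] of positive mass combine. *)
Lemma locally_euclidean_prod (n : nat) :
  locally_euclidean n (polyhedron (R := R) d c) ->
  locally_euclidean n.+1 (polyhedron (R := R) d.+1 c').
Proof.
move=> le x xK.
pose m1 (z : 'rV[R]_#|V'|) := point_of_weights (marginal1 (weight z)).
pose m2 (z : 'rV[R]_#|V'|) := marginal2 (weight z).
have m1E z : weight (m1 z) = marginal1 (weight z).
  by apply/funext => v; rewrite weight_point.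
have split z : polyhedron d.+1 c' z ->
    [/\ polyhedron d c (m1 z), circle_weights (m2 z) &
        coupling rk (weight (m1 z)) (m2 z) =1 weight z].
  by move/polyhedronP/(prod_facet_weights bal)=> [h1 h2 h3]; split=> //; rewrite ?m1E //;
     apply/polyhedronP; rewrite m1E.
have join u nu : polyhedron d c u -> circle_weights nu ->
    let z := point_of_weights (coupling rk (weight u) nu) in
    [/\ polyhedron d.+1 c' z, m1 z = u & m2 z = nu].
  move=> /polyhedronP uK cnu /=; have [z [zK zu znu]] := exists_coupling bal uK cnu.
  have [_ _ E] := prod_facet_weights bal zK.
  have -> : coupling rk (weight u) nu = z.
    apply/funext => w; rewrite -E; congr (coupling rk _ _ w); apply/funext => v.
      by rewrite zu.
    by rewrite znu.
  have zE : weight (point_of_weights z) = z by apply/funext => w; rewrite weight_point.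
  split; first by apply/polyhedronP; rewrite zE.
    by apply: eq_weight => v; rewrite m1E zE zu.
  by apply/funext => q; rewrite /m2 zE znu.
have [uK nuC _] := split x xK.
have [W [f [g [[oW Wu] cf cg gP fK]]]] := le (m1 x) uK.
have [q nuq] : exists q, 0 < m2 x q.
  apply: contrapT => nq; have [nu0 + _] := nuC; rewrite -sum_bool2 big1 => [|q _].
    by move/eqP; rewrite eq_sym oner_eq0.
  by apply/eqP; rewrite eq_le nu0 andbT leNgt; apply/negP => h; apply: nq; exists q.
have cm1 : continuous m1.
  by move=> z; apply: cts_point => v; apply: cts_marginal1 => w; exact: weight_continuous.
have cm2 q' z : {for z, continuous (fun z => m2 z q')}.
  by apply: cts_marginal2 => w; exact: weight_continuous.
pose f' z : 'rV[R]_(1 + n) := row_mx (\row_(_ < 1) circle_coord q (m2 z)) (f (m1 z)).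
pose nu' (y : 'rV[R]_(1 + n)) := circle_point q (lsubmx y ord0 ord0).
pose g' y := point_of_weights (coupling rk (weight (g (rsubmx y))) (nu' y)).
have f'E z : lsubmx (f' z) ord0 ord0 = circle_coord q (m2 z) by rewrite row_mxKl mxE.
have f'Er z : rsubmx (f' z) = f (m1 z) by rewrite row_mxKr.
exists ([set z | W (m1 z)] `&` [set z | 0 < m2 z q]), f', g'; split.
- split=> //; apply: openI; first by apply: (@open_comp _ _ m1 W) => // z _; exact: cm1.
  apply: (@open_comp _ _ (fun z => m2 z q) [set r | 0 < r]); last exact: open_gt.
  by move=> z _; exact: cm2.
- move=> z [Wz qz]; apply: (@cts_rV _ _ _ (1 + n)) => j.
  have cc : {for z, continuous (fun z => circle_coord q (m2 z))}.
    apply: cts_div; first by rewrite gt_eqF.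
      by apply: cts_add; [exact: cm2|apply: cts_opp; exact: cm2].
    exact: cm2.
  have cfm : {for z, continuous (fun z => f (m1 z))}.
    by apply: (@continuous_comp _ _ _ m1 f); [exact: cm1|exact: cf].
  case: (split_ordP j) => k ->.
    rewrite (_ : (fun z => _) = fun z => circle_coord q (m2 z)) //.
    by apply/funext => a; rewrite /f' row_mxEl mxE.
  rewrite (_ : (fun z => _) = fun z => f (m1 z) ord0 k); first exact: cts_coord.
  by apply/funext => a; rewrite /f' row_mxEr.
- move=> y; apply: cts_point => w; apply: cts_coupling => [v|q'].
    apply: (@continuous_comp _ _ _ (fun y : 'rV[R]_(1 + n) => g (rsubmx y))
      (fun x => weight x v)); last exact: weight_continuous.
    apply: (@continuous_comp _ _ _ (fun y : 'rV[R]_(1 + n) => rsubmx y) g); last exact: cg.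
    apply: cts_rV => j; rewrite (_ : (fun y => _) = fun y : 'rV[R]_(1 + n) => y ord0 (rshift 1 j)).
      exact: coord_continuous.
    by apply/funext => a; rewrite mxE.
  apply: cts_circle_point.
  rewrite (_ : (fun y => _) = fun y : 'rV[R]_(1 + n) => y ord0 (lshift n ord0)).
    exact: coord_continuous.
  by apply/funext => a; rewrite mxE.
- move=> y; have [Wg Kg fg] := gP (@rsubmx R 1 1 n y).
  have [cn q0 cq] := circle_pointP q (@lsubmx R 1 1 n y ord0 ord0).
  have [zK zm1 zm2] := join _ _ Kg cn.
  split; [split|by []|].
  + by rewrite /= /g' zm1.
  + by rewrite /= /g' zm2.
  + rewrite /f' /g' zm1 zm2 fg cq.
    have -> : \row_(_ < 1) @lsubmx R 1 1 n y ord0 ord0 = @lsubmx R 1 1 n y.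
      by apply/rowP => j; rewrite mxE [j]ord1.
    exact: (@hsubmxK R 1 1 n y).
- move=> z [Wz qz] zK; have [uz cz E] := split z zK.
  apply: eq_weight => w; rewrite /g' weight_point f'Er fK // -E; congr (coupling rk _ _ w).
  by apply/funext => q'; rewrite /nu' f'E circle_coordK.
Qed.

End ProductChart.

(** * The class of dual graphs *)

(** [B] is chosen before [n], which makes the number of facets linear in the size of the permuted
    set. *)
Lemma coloured_manifolds (R : realType) (k : nat) :
  exists2 B : nat, (0 < B)%N & forall n, exists (F V : finType) (rk : V -> nat)
    (c : {perm 'I_n.+1} -> nat -> F -> V) (t : {perm 'I_n.+1} -> nat -> F -> F) (z : F),
  [/\ #|F| = (B * n.+1)%N,
      forall sigma, balanced k.+2 rk (c sigma) (t sigma),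
      forall sigma, locally_euclidean k.+2 (polyhedron (R := R) k.+2 (c sigma)) &
      decodable k.+2 t z].
Proof.
elim: k => [|k [B B0 IH]].
  (* Two bits and twelve arcs for each element. *)
  exists 48%N => // n.
  exists (hex_facet 'I_n.+1), (hex_vertex 'I_n.+1), (@hex_rk _),
    (fun sigma => hex_c (hex_perms sigma)), (fun sigma => hex_t (hex_perms sigma)),
    (((ord0, false), false), ord0); split.
  - by rewrite /hex_facet !card_prod !card_bool !card_ord; lia.
  - by move=> sigma; exact: balanced_hex.
  - move=> sigma; apply: locally_euclidean_links => i x id; exact: hex_vertex_link.
  - exact: decodable_hex.
(* Over each facet there are [k.+3] positions of the step and four edges of the 4-cycle. *)
exists (B * (k.+3 * 4))%N; first by rewrite muln_gt0 B0.
move=> n; have [F [V [rk [c [t [z [cF bal le dec]]]]]]] := IH n.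
exists (prod_facet F k.+2), (prod_vertex V), (prod_rk rk),
  (fun sigma => prod_c (d := k.+2) (c sigma)), (fun sigma => prod_t (d := k.+2) (t sigma)),
  (ord_max, z, (false, false)); split.
- by rewrite /prod_facet !card_prod !card_bool !card_ord cF; lia.
- by move=> sigma; exact: balanced_prod (bal sigma).
- by move=> sigma; exact: (locally_euclidean_prod (bal sigma) (le sigma)).
- exact: decodable_prod dec.
Qed.

Lemma regular_dual_facet_graph (R : realType) (F V : finType) (d : nat) (rk : V -> nat)
    (c : nat -> F -> V) (t : nat -> F -> F) (bal : balanced d rk c t) :
  (0 < d)%N -> locally_euclidean d (polyhedron (R := R) d c) ->
  regular_dual_graphs R d (facet_graph bal).
Proof.
move=> d0 le; split; first exact: facet_graph_regular.
exists (set_type (polyhedron (R := R) d c)), #|V|, (balanced_complex d c); split.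
- by apply: compact_manifold_set_type le; exact: compact_polyhedron.
- split; first exact: simplicial_balanced_complex.
  by exists id, id; split=> // x; exact: cvg_id.
- exact: isomorphic_facet_graph.
Qed.

(** The copy [G'] allows the bounds to be checked on representatives of isomorphism types. *)
Lemma small_of_bounded_tww (R : realType) (C : sgraph -> Prop) (D k : nat) :
  (forall G, C G -> (0 < #|G|)%N -> exists G' : sgraph,
     [/\ isomorphic G G', forall x : G', (#|[pred y | adj x y]| <= D)%N &
         exists2 j, (j <= k)%N & full_contraction_sequence (trigraph_of_sgraph G') j]) ->
  small R C.
Proof.
move=> CP; exists (2 ^ (1 + 8 * (4 * (k + D).+1).*2))%:R.
  by rewrite ltr1n -[ltnLHS](expn0 2) ltn_exp2l.
move=> n; rewrite -natrX -natrM ler_nat; apply: (@card_tww_labelled D k) => A.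
rewrite inE => /asboolP[G CG [f fbij fA]] n0.
have G0 : (0 < #|G|)%N by rewrite -(bij_eq_card fbij) card_ord.
have [G' [[h hbij hA] degD tw]] := CP G CG G0; exists G'; split=> //.
by exists (h \o f) => [|i j /=]; [exact: bij_comp|rewrite hA].
Qed.

Lemma infinite_class_not_small (R : realType) (C : sgraph -> Prop) :
  ~ small R C -> infinite_class C.
Proof.
move=> nsmall [m [H HP]]; apply: nsmall.
have /choice[k kP] : forall i, exists k, (0 < #|H i|)%N ->
    full_contraction_sequence (trigraph_of_sgraph (H i)) k.
  move=> i; have [H0|H0] := boolP (0 < #|H i|)%N; last by exists 0%N.
  by have [k kP] := @exists_full_contraction_sequence (trigraph_of_sgraph (H i)) H0; exists k.
apply: (@small_of_bounded_tww _ _ (\max_i #|H i|) (\max_i k i)) => G /HP[i GH] G0.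
exists (H i); split=> // [x|].
  by apply: leq_trans (max_card _) _; exact: (leq_bigmax i).
exists (k i); first exact: (leq_bigmax i).
by apply: kP; case: GH => f fbij _; rewrite -(bij_eq_card fbij).
Qed.

Lemma regular_dual_graphs_not_small (R : realType) (d : nat) :
  (2 <= d)%N -> ~ small R (regular_dual_graphs R d).
Proof.
case: d => [|[|k]] // _ [c c1 cP]; have [B B0 BP] := coloured_manifolds R k.
(* With [N = B * n.+1] facets, smallness bounds the factorial of [n.+1] by [c ^ N * K ^ N * N],
   hence by [(c * K * 2) ^ N], and [M] bounds the base when this is written as a power with exponent
   [n.+1]. *)
pose K := (k.+3 ^ k.+3)%N; pose M := Num.bound ((c * K%:R * 2) ^+ B).
have cK0 : 0 <= c * K%:R * 2 by rewrite !mulr_ge0 // ltW // (lt_trans ltr01).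
have [n] := exists_fact_gt_exp M; rewrite ltnNge => /negP; apply.
have [F [V [rk [cv [t [z [cF bal le dec]]]]]]] := BP n.
have LP s (f : 'I_#|F| -> F) : bijective f ->
    \matrix_(i, j) facet_rel k.+2 (t s) (f i) (f j) \in
      labeled_graphs (regular_dual_graphs R k.+2) #|F|.
  move=> fbij; rewrite inE; apply/asboolP; exists (facet_graph (bal s)).
    exact: regular_dual_facet_graph.
  by exists f => // i j; rewrite mxE.
have := card_labelled_facet_graphs bal dec LP.
rewrite card_Sn.
move=> cardL; have {}cardL : (n.+1`!)%:R <= c ^+ #|F| * (K ^ #|F| * #|F|)%:R.
  have N0 : 0 < ((#|F|)`!)%:R :> R by rewrite ltr0n fact_gt0.
  rewrite -(ler_pM2r N0) -natrM; rewrite -(ler_nat R) in cardL; apply: (le_trans cardL).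
  rewrite natrM [leRHS]mulrAC; apply: ler_wpM2r; first by rewrite ler0n.
  by rewrite mulrC; exact: cP.
rewrite -(ler_nat R); apply: (le_trans cardL).
apply: (@le_trans _ _ ((c * K%:R * 2) ^+ #|F|)).
  rewrite !exprMn natrM natrX mulrA; apply: ler_wpM2l.
    by rewrite mulr_ge0 ?exprn_ge0 // ltW // (lt_trans ltr01).
  by rewrite -natrX ler_nat ltnW // ltn_expl.
rewrite cF exprM natrX lerXn2r ?nnegrE ?exprn_ge0 //.
by apply: ltW; apply: archi_boundP; rewrite exprn_ge0.
Qed.

Theorem theorem21 (R : realType) (d : nat) (hd : (3 <= d)%N) :
  [/\ infinite_class (regular_dual_graphs R d),
      ~ small R (regular_dual_graphs R d) &
      forall k : nat, exists (G : sgraph) (t : nat),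
        [/\ regular_dual_graphs R d G,
            is_twin_width (trigraph_of_sgraph G) t &
            (k <= t)%N]].
Proof.
have nsmall : ~ small R (regular_dual_graphs R d).
  by apply: regular_dual_graphs_not_small; exact: ltnW.
split=> //; first exact: infinite_class_not_small nsmall.
move=> k; apply: contrapT => no; apply: nsmall.
apply: (@small_of_bounded_tww _ _ d.+1 k) => G CG G0; exists G; split.
- by exists id => //; exists id.
- by move=> x; case: CG => -> _.
have [j0 fj0] := @exists_full_contraction_sequence (trigraph_of_sgraph G) G0.
have ex : exists j, `[< full_contraction_sequence (trigraph_of_sgraph G) j >].
  by exists j0; apply/asboolP.
have [t /asboolP ft tmin] := ex_minnP ex.
exists t => //; rewrite leqNgt; apply/negP => kt; apply: no; exists G, t; split=> //.
  by split=> // j fj; apply: tmin; apply/asboolP.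
exact: ltnW.
Qed.
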